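(* Let $X_1, X_2$ be locally compact Polish spaces and let $G=(\pi_1,\pi_2)$ be a game in which each payoff $\pi_i : X_1\times X_2\to\mathbb{R}$ is bounded and of Baire class one. Then a strategy is rationalizable in $G$ if and only if it is consistent with Rationality and Common Belief in Rationality, that is, $\mathrm{RAT}_i(G)=\mathrm{RCBR}_i(G)$ for each $i\in\{1,2\}$.
   Context: Conventions. For a Polish space $X$, $\Delta(X)$ is the Polish space of Borel probability measures on $X$ (weak topology). A measure $\mu\in\Delta(X)$ is identified with its completion; for an arbitrary $S\subseteq X$, ''$\mu(S)=1$'' means $S$ is measurable for the completion of $\mu$ and has measure one. $\mathrm{marg}$ denotes marginal measures. Always $\{i,j\}=\{1,2\}$: $j$ is the player other than $i$. Games. A (two-person strategic form) game $G=(\pi_1,\pi_2)$ is a pair of bounded (universally measurable) functions $\pi_i:X_1\times X_2\to\mathbb{R}$, with $X_1,X_2$ Polish (strategy spaces). For $s\in X_i$ and $\mu\in\Delta(X_j)$, $\pi_i(s,\mu)$ is the integral over $y\in X_j$ with respect to $\mu$ of player $i$'s payoff when $i$ plays $s$ and $j$ plays $y$. $s$ is a best response to $\mu$ if $\pi_i(s,\mu)\ge\pi_i(\bar s,\mu)$ for all $\bar s\in X_i$. Let $E_i^G=\{(s,\mu)\in X_i\times\Delta(X_j) : s\text{ is a best response to }\mu\}$. Rationalizability. Put $X_i^0=X_i$; $X_i^{\alpha+1}=\{s\in X_i^\alpha : \exists\mu\in\Delta(X_j)\ (\mu(X_j^\alpha)=1 \text{ and } (s,\mu)\in E_i^G)\}$;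 and $X_i^\alpha=\bigcap_{\beta<\alpha}X_i^\beta$ for limit $\alpha$. With $\alpha$ least such that $X_i^{\alpha+1}=X_i^\alpha$ for both $i$, $\mathrm{RAT}_i(G)=X_i^\alpha$ is the set of rationalizable strategies of player $i$. Type spaces. Put $X_i^{(0)}=X_j$ and $X_i^{(n)}=X_i^{(n-1)}\times\Delta(X_j^{(n-1)})$ for $n>0$. Let $T_i^0=\prod_{n>0}\Delta(X_i^{(n-1)})$, and let $T_i^1\subseteq T_i^0$ be the set of sequences $\delta_i=(\delta_i^1,\delta_i^2,\dots)$ with $\mathrm{marg}_{X_i^{(n-2)}}(\delta_i^n)=\delta_i^{n-1}$ for all $n>1$. By Kolmogorov extension each $\delta_i\in T_i^1$ determines a unique $\delta_i^*\in\Delta(X_j\times T_j^0)$ with $\mathrm{marg}_{X_i^{(n)}}\delta_i^*=\delta_i^{n+1}$ for all $n\ge 0$. For $k>1$ let $T_i^k=\{\delta_i\in T_i^1:\delta_i^*(X_j\times T_j^{k-1})=1\}$ and $T_i=\bigcap_{k\geq 1}T_i^k$. Then $T_i$ is Polish and $\lambda_i(\delta_i)=\delta_i^*$ defines a homeomorphism $\lambda_i:T_i\to\Delta(X_j\times T_j)$. RCBR. Let $R_i^1=\{(s,t)\in X_i\times T_i : (s,\mathrm{marg}_{X_j}\lambda_i(t))\in E_i^G\}$ and $R_i^{n+1}=\{(s,t)\in R_i^n : \lambda_i(t)(R_j^n)=1\}$ for $n\ge1$. $\mathrm{RCBR}_i(G)=\{s\in X_i:\exists t\in T_i\ \forall n\ge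 1\ (s,t)\in R_i^n\}$ is the set of strategies of player $i$ consistent with Rationality and Common Belief in Rationality. *)

(* Defs.v *)
(* MathComp-Analysis *)
From HB Require Import structures.
From mathcomp Require Import all_boot all_order all_algebra.
From mathcomp Require Import all_classical all_reals all_analysis.

Set Implicit Arguments.
Unset Strict Implicit.
Unset Printing Implicit Defensive.

Import Order.TTheory GRing.Theory Num.Theory.
Import numFieldNormedType.Exports.

Local Open Scope classical_set_scope.
Local Open Scope ring_scope.

Definition polish (R : realType) (X : topologicalType) : Prop :=
  (exists2 D : set X, countable D & dense D) /\
  exists d : X -> X -> R,
    [/\ [/\ forall x y, 0 <= d x y,
            forall x y, d x y = 0 <-> x = y,
            forall x y, d x y = d y x
          & forall x y z, d x z <= d x y + d y z],
        forall (x : X) (A : set X),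
          nbhs x A <-> exists2 e : R, 0 < e & [set y | d x y < e] `<=` A
      & forall u : nat -> X,
          (forall e : R, 0 < e ->
             exists N, forall m n, (N <= m)%N -> (N <= n)%N -> d (u m) (u n) < e) ->
          exists l : X, u n @[n --> \oo] --> l].

Definition baire_class_one (R : realType) (X : topologicalType) (f : X -> R) :=
  exists2 g : nat -> X -> R,
    forall n, continuous (g n) & forall x, g n x @[n --> \oo] --> f x.

(* Measurable types are pointed in the library.  A space carrying a probability
   measure is nonempty, and the base point is chosen from the (proof-irrelevant)
   nonemptiness, so that the Borel structure does not depend on it. *)
Definition with_point (X : topologicalType) (h : [set: X] !=set0) : Type := X.

HB.instance Definition _ (X : topologicalType) (h : [set: X] !=set0) := Choice.on (with_point h).
HB.instance Definition _ (X : topologicalType) (h : [set: X] !=set0) :=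
  isPointed.Build (with_point h) (sval (cid h)).

Definition borel_open (X : topologicalType) (h : [set: X] !=set0) :
    set (set (with_point h)) :=
  @open X.
Arguments borel_open {X} h _.

Notation borel h := (g_sigma_algebraType (borel_open h)).

(* Library measures are total set functions, with arbitrary values outside the
   sigma-algebra.  Setting these values to 0 makes two elements of [Delta R X]
   equal as soon as they agree on Borel sets. *)
Record Delta (R : realType) (X : topologicalType) := MkDelta {
  Delta_nonempty : [set: X] !=set0 ;
  Delta_prob :> probability (borel Delta_nonempty) R ;
  Delta_out : forall A : set (borel Delta_nonempty),
    ~ measurable A -> Delta_prob A = 0%E
}.

HB.instance Definition _ R X := gen_eqMixin (Delta R X).
HB.instance Definition _ R X := gen_choiceMixin (Delta R X).

Definition bounded_continuous (R : realType) (X : topologicalType) :=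
  {f : X -> R | continuous f /\ bounded_fun f}.

HB.instance Definition _ R X := gen_eqMixin (bounded_continuous R X).
HB.instance Definition _ R X := gen_choiceMixin (bounded_continuous R X).

Definition Delta_eval (R : realType) (X : topologicalType) (mu : Delta R X) :
    {ptws bounded_continuous R X -> R} :=
  fun f => \int[mu]_x (sval f x).

(* The weak topology. *)
HB.instance Definition _ R X :=
  Topological.copy (Delta R X) (initial_topology (@Delta_eval R X)).

(* mu(S) = 1 for the completion of mu. *)
Definition full_measure (R : realType) (X : topologicalType) (mu : Delta R X)
    (S : set X) : Prop :=
  exists A N : set (borel (Delta_nonempty mu)),
    [/\ measurable A, mu.-negligible N, S = A `|` N & mu A = 1%E].

Section image_measure.
Context (R : realType) (X Y : topologicalType) (f : X -> Y).
Hypothesis cf : continuous f.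
Variable mu : Delta R X.

Let hX := Delta_nonempty mu.

Fact image_nonempty : [set: Y] !=set0.
Proof. by case: hX => x _; exists (f x). Qed.

Let hY := image_nonempty.

Lemma continuous_borel_measurable :
  measurable_fun setT (f : borel hX -> borel hY).
Proof.
apply: (@measurability _ _ (borel hX) (borel hY) setT f (borel_open hY)) => //.
move=> _ [B oB <-]; rewrite setTI; apply: sub_sigma_algebra.
by move/continuousP: cf; apply.
Qed.

Definition image_fun (A : set (borel hY)) : \bar R :=
  if `[< measurable A >] then mu (f @^-1` A) else 0%E.

Let image_funE A : measurable A -> image_fun A = pushforward mu
  (f : borel hX -> borel hY) A.
Proof. by move=> mA; rewrite /image_fun asboolT. Qed.

Let image_fun0 : image_fun set0 = 0%E.
Proof. by rewrite image_funE// /pushforward preimage_set0 measure0. Qed.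

Let image_fun_ge0 A : (0 <= image_fun A)%E.
Proof. by rewrite /image_fun; case: ifP. Qed.

Let image_fun_sigma_additive : semi_sigma_additive image_fun.
Proof.
move=> F mF tF mUF; rewrite image_funE//.
have -> : (fun n => (\sum_(0 <= i < n) image_fun (F i))%E) =
    (fun n => (\sum_(0 <= i < n)
       pushforward mu (f : borel hX -> borel hY) (F i))%E).
  by apply/funext => n; apply: eq_bigr => i _; rewrite image_funE.
rewrite /pushforward preimage_bigcup.
have mf B : measurable B -> measurable ((f : borel hX -> borel hY) @^-1` B).
  by move=> mB; rewrite -[X in measurable X]setTI;
    exact: continuous_borel_measurable.
apply: measure_semi_sigma_additive.
- by move=> n; exact: mf.
- apply/trivIsetP => /= i j _ _ ij; rewrite -preimage_setI.
  by move/trivIsetP : tF => /(_ _ _ _ _ ij) ->//; rewrite preimage_set0.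
- by rewrite -preimage_bigcup; exact: mf.
Qed.

HB.instance Definition _ := isMeasure.Build _ _ _ image_fun
  image_fun0 image_fun_ge0 image_fun_sigma_additive.

Let image_funT : image_fun setT = 1%E.
Proof.
by rewrite image_funE// /pushforward preimage_setT probability_setT.
Qed.

HB.instance Definition _ :=
  Measure_isProbability.Build _ _ _ image_fun image_funT.

Fact image_fun_out (A : set (borel hY)) : ~ measurable A -> image_fun A = 0%E.
Proof. by move=> mA; rewrite /image_fun asboolF. Qed.

(* The image of mu under f; when f is a projection, a marginal of mu. *)
Definition Delta_map : Delta R Y := MkDelta image_fun_out.

End image_measure.

Lemma continuous_fst (X Y : topologicalType) : continuous (@fst X Y).
Proof. by move=> x; exact: cvg_fst. Qed.

Definition marg_fst (R : realType) (X Y : topologicalType)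
    (mu : Delta R (X * Y)%type) : Delta R X :=
  Delta_map (@continuous_fst X Y) mu.

(* The players 1 and 2 are [false] and [true]; the player other than [i] is
   [~~ i].  Payoffs are functions of (strategy of 1, strategy of 2); [payoff]
   lists the player's own strategy first. *)
Definition payoff (R : realType) (X : bool -> topologicalType)
    (pi : bool -> X false * X true -> R) (i : bool) : X i -> X (~~ i) -> R :=
  match i with
  | false => fun s y => pi false (s, y)
  | true => fun s y => pi true (y, s)
  end.

Section game.
Context (R : realType) (X : bool -> topologicalType).
Variable pi : bool -> X false * X true -> R.

Definition expected_payoff i (s : X i) (mu : Delta R (X (~~ i))) : R :=
  \int[mu]_y payoff pi s y.

Definition best_response i (s : X i) (mu : Delta R (X (~~ i))) : Prop :=
  forall s' : X i, expected_payoff s' mu <= expected_payoff s mu.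

Definition eliminate (S : forall i, set (X i)) : forall i, set (X i) :=
  fun i => [set s | S i s /\
    exists2 mu : Delta R (X (~~ i)),
      full_measure mu (S (~~ i)) & best_response s mu].
Arguments eliminate S i _ : clear implicits.

(* Ordinals are the elements of arbitrary well-ordered types [W]; the stages
   X^a, for a in W, are determined by transfinite recursion. *)
Section stages.
Context (d : Order.disp_t) (W : orderType d).

Definition is_zero (a : W) := forall b : W, (a <= b)%O.
Definition is_succ (a b : W) := (a < b)%O /\ forall c : W, (a < c)%O -> (b <= c)%O.
Definition is_limit (a : W) := ~ is_zero a /\ forall b : W, ~ is_succ b a.

Definition elimination_stages (Y : W -> forall i, set (X i)) : Prop :=
  [/\ forall a, is_zero a -> forall i, Y a i = setT,
      forall a b, is_succ a b -> forall i, Y b i = eliminate (Y a) i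
    & forall a, is_limit a ->
        forall i, Y a i = \bigcap_(b in [set b : W | (b < a)%O]) Y b i].

Definition stable_stage (Y : W -> forall i, set (X i)) (a : W) : Prop :=
  forall i, eliminate (Y a) i = Y a i.

End stages.

Definition RAT (i : bool) : set (X i) := [set s |
  exists (d : Order.disp_t) (W : orderType d) (Y : W -> forall i, set (X i))
         (a : W),
    [/\ well_founded (fun b c : W => (b < c)%O),
        elimination_stages Y,
        stable_stage Y a,
        forall b, (b < a)%O -> ~ stable_stage Y b
      & Y a i s]].

End game.

Arguments RAT {R X} pi i _.

Section type_spaces.
Context (R : realType) (X : bool -> topologicalType).

(* X_i^(n) *)
Fixpoint level (n : nat) (i : bool) : topologicalType :=
  match n with
  | 0 => X (~~ i)
  | n'.+1 => (level n' i * Delta R (level n' (~~ i)))%type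
  end.

(* T_i^0; coordinates are numbered from 0, so that [delta n] is the belief of
   order n + 1, an element of Delta(X_i^(n)). *)
Definition hierarchy (i : bool) : topologicalType :=
  prod_topology (fun n => Delta R (level n i)).

(* T_i^1 *)
Definition coherent (i : bool) : set (hierarchy i) :=
  [set delta : hierarchy i | forall n, marg_fst (delta n.+1) = delta n].

(* X_i^(n) as a factor of X_j x T_j^0. *)
Fixpoint level_proj (n : nat) (i : bool) :
    X (~~ i) * hierarchy (~~ i) -> level n i :=
  match n with
  | 0 => fun p => p.1
  | n'.+1 => fun p => (level_proj n' p, p.2 n')
  end.

Lemma continuous_level_proj n i : continuous (@level_proj n i).
Proof.
elim: n i => [|n IHn] i p; first exact: cvg_fst.
have cn : continuous (fun q : X (~~ i) * hierarchy (~~ i) => q.2 n).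
  move=> q; apply: (@continuous_comp _ _ _ (@snd (X (~~ i)) (hierarchy (~~ i)))
    (@proj nat (fun n => Delta R (level n (~~ i))) n)).
    exact: cvg_snd.
  exact: proj_continuous.
exact: (cvg_pair (IHn i p) (cn p)).
Qed.

(* [nu] is delta^*.  For Polish strategy spaces and coherent delta, such a measure
   exists and is unique (Kolmogorov extension), so that a statement about
   delta^* can be written [exists nu, extends delta nu /\ ...]. *)
Definition extends (i : bool) (delta : hierarchy i)
    (nu : Delta R (X (~~ i) * hierarchy (~~ i))%type) : Prop :=
  forall n, Delta_map (@continuous_level_proj n i) nu = delta n.

(* T_i^(k + 1) *)
Fixpoint type_approx (k : nat) (i : bool) : set (hierarchy i) :=
  match k with
  | 0 => @coherent i
  | k'.+1 => [set delta : hierarchy i | coherent delta /\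
      exists nu, extends delta nu /\
        full_measure nu [set p | type_approx k' p.2]]
  end.

(* T_i *)
Definition types (i : bool) : topologicalType :=
  set_type (\bigcap_k @type_approx k i).

Definition types_incl (i : bool) (p : X i * types i) : X i * hierarchy i :=
  (p.1, set_val p.2).

Lemma continuous_types_incl i : continuous (@types_incl i).
Proof.
have cv : continuous (fun q : X i * types i => set_val q.2 : hierarchy i).
  move=> q; apply: (@continuous_comp _ _ _ (@snd (X i) (types i)) set_val).
    exact: cvg_snd.
  exact: initial_continuous.
by move=> p; exact: (cvg_pair (cvg_fst) (cv p)).
Qed.

(* lambda_i(t) = nu: seen as a measure on X_j x T_j^0, [nu] is t^*.  Again there
   is exactly one such [nu] for each [t] in the Polish case. *)
Definition belief (i : bool) (t : types i)
    (nu : Delta R (X (~~ i) * types (~~ i))%type) : Prop :=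
  extends (set_val t) (Delta_map (@continuous_types_incl (~~ i)) nu).

Variable pi : bool -> X false * X true -> R.

(* R_i^(n + 1) *)
Fixpoint rational_belief (n : nat) (i : bool) : set (X i * types i) :=
  match n with
  | 0 => [set st : X i * types i | exists nu, belief st.2 nu /\
            best_response pi st.1 (marg_fst nu)]
  | n'.+1 => [set st : X i * types i | rational_belief n' st /\
            exists nu, belief st.2 nu /\
              full_measure nu (@rational_belief n' (~~ i))]
  end.

Definition RCBR (i : bool) : set (X i) :=
  [set s | exists t : types i, forall n, rational_belief n (s, t)].

End type_spaces.

Arguments RCBR {R X} pi i _.

(* Main.v *)
(* A strategy is rationalizable iff it lies in a family S such that each s in S i is
   a best response to a belief concentrated on S (~~ i). The strategies consistent
   with RCBR form such a family, except that S (~~ i) need not be measurable and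
   only has outer measure 1. Conversely, let S be such a family in the weaker outer
   sense. Code each s in S i by a sequence of naturals that records s, the
   conditional probabilities of initial segments of the opponent's code under a
   supporting belief of s, and moduli witnessing the best response property. Local
   compactness and the Baire class one hypothesis (pi is a pointwise limit of
   continuous functions) make these moduli closed conditions on the codes. The
   closure Theta i of the codes in Baire space then carries a continuous strategy
   map sigma : Theta i -> X i and a continuous belief map
   beta : Theta i -> Delta (Theta (~~ i)), each state playing a best response to its
   belief. Continuity of beta unfolds each state into a point of the universal type
   space, and beta t is concentrated on a countable union of compact sets, whose
   images under continuous maps are measurable. Hence every sigma t, and with it
   every s in S i, is both rationalizable and consistent with RCBR. *)
Require Import Defs.
From HB Require Import structures.
From mathcomp Require Import all_boot all_order all_algebra.
From mathcomp Require Import all_classical all_reals all_analysis.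
From mathcomp Require Import measurable_realfun ring lra.
Import Order.TTheory GRing.Theory Num.Theory.
Import numFieldNormedType.Exports.
Set Implicit Arguments.
Unset Strict Implicit.
Unset Printing Implicit Defensive.
Local Open Scope classical_set_scope.
Local Open Scope ring_scope.

(** A code has to describe a distribution of opposing codes, which is circular, and the map from
    strategies to codes need not be measurable, since S is arbitrary. The circle is harmless because
    entry n reads only the probabilities of words of length at most n, and these depend only on
    earlier entries. Measurability is restored by measurable hulls: an opposing strategy y receives,
    digit by digit, the first digit whose set of strategies has a hull containing y. The code
    selected in this way may differ from that of y, yet almost surely its recorded points still
    converge to y, so the belief over codes projects back to the original belief. Beliefs over codes
    are compared through quantile maps on [0, 1[: if the weights of all words converge, the branches
    converge almost everywhere, and continuity of [beta] becomes dominated convergence. A payoff of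
    Baire class one need not be semicontinuous, so optimality alone can be lost in a limit. A choice
    among finitely many ranks is not lost, hence the recorded bounds on ranks. One bound must serve
    uncountably many competitors, and compactness supplies it. *)

(** * Probability preliminaries *)

Section bounded_integrals.
Context d (T : measurableType d) (R : realType) (P : probability T R).
Implicit Types f g : T -> R.

Lemma bounded_integrable f M : measurable_fun setT f ->
  (forall x, `|f x| <= M) -> P.-integrable setT (EFin \o f).
Proof.
move=> mf fM; apply: (@le_integrable _ _ _ _ _ _ _ (EFin \o cst M)) => //.
- exact/measurable_EFinP.
- by move=> x _ /=; rewrite lee_fin (le_trans (fM x))// ler_norm.
- exact: finite_measure_integrable_cst.
Qed.

Lemma dominated_Rintegral (f_ : nat -> T -> R) f M :
  (forall n, measurable_fun setT (f_ n)) -> measurable_fun setT f ->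
  (forall n x, `|f_ n x| <= M) ->
  {ae P, forall x, f_ ^~ x n @[n --> \oo] --> f x} ->
  \int[P]_x f_ n x @[n --> \oo] --> \int[P]_x f x.
Proof.
move=> mf_ mf fM ff.
have [ |||||if_ _ cf] := @dominated_convergence _ _ _ P _ measurableT
    (fun n => EFin \o f_ n) (EFin \o f) (EFin \o cst M).
- by move=> n; exact/measurable_EFinP.
- exact/measurable_EFinP.
- apply: filterS ff => x fx _; apply: cvg_EFin; [exact: nearW|exact: fx].
- exact: finite_measure_integrable_cst.
- by apply: aeW => x n _; rewrite /= lee_fin.
apply: fine_cvg; rewrite fineK //.
exact: integrable_fin_num.
Qed.

Lemma Rintegral_prob_cst (r : R) : \int[P]_x r = r.
Proof.
rewrite Rintegral_cst// -[RHS]mulr1; congr (_ * _).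
exact: (congr1 fine (probability_setT P)).
Qed.

Lemma probability_eq1 A B : measurable A -> measurable B -> A `<=` B ->
  P A = 1%E -> P B = 1%E.
Proof.
move=> mA mB AB PA; apply/eqP; rewrite eq_le probability_le1//= -PA.
by apply: le_measure; rewrite ?inE.
Qed.

Lemma probability_bigcap1 (A : nat -> set T) : (forall n, measurable (A n)) ->
  (forall n, P (A n) = 1%E) -> P (\bigcap_n A n) = 1%E.
Proof.
move=> mA PA; have mC n : measurable (~` A n) by exact: measurableC.
have C0 : P (\bigcup_n ~` A n) = 0.
  apply: measure_negligible; first exact: bigcupT_measurable.
  apply: negligible_bigcup => n; apply/negligibleP => //.
  by apply: etrans (probability_setC P (mA n)) _; rewrite PA subee.
rewrite -[X in P X]setCK setC_bigcap.
have mU : measurable (\bigcup_n ~` A n) by exact: bigcupT_measurable.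
by apply: etrans (probability_setC P mU) _; rewrite C0 sube0.
Qed.

(** Let f n exceed b k n with probability at most 2^-k / 2^(n+1). Summing over n, the k-th set
    misses mass at most 2^-k, so the union over k misses none. For the coordinates of Baire space
    these sets are relatively compact, so this is tightness. *)
Lemma probability_tight (f : nat -> T -> nat) :
  (forall n c, measurable [set t | (c < f n t)%N]) ->
  exists b : nat -> nat -> nat,
    P (\bigcup_k [set t | forall n, (f n t <= b k n)%N]) = 1%E.
Proof.
move=> mf; pose A n c := [set t | (c < f n t)%N].
have A0 n (e : R) : 0 < e -> exists c, (P (A n c) <= e%:E)%E.
  move=> e0.
  have : P \o A n @ \oo --> P (\bigcap_c A n c).
    apply: nonincreasing_cvg_mu.
    - exact: le_lt_trans (probability_le1 P (mf n 0%N)) (ltry _).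
    - exact: mf.
    - by apply: bigcapT_measurable => c; exact: mf.
    - by move=> c c' cc'; apply/subsetPset => t; exact: leq_ltn_trans.
  have -> : \bigcap_c A n c = set0.
    by apply/seteqP; split=> // t /(_ (f n t) I); rewrite /A/= ltnn.
  rewrite measure0 => /fine_cvgP[_]; move=> /cvgrPdist_le/(_ _ e0)[c _].
  move=> /(_ c (leqnn c)) /=; rewrite sub0r normrN => h; exists c.
  rewrite -(fineK (fin_num_measure P _ (mf n c))) lee_fin.
  exact: le_trans (ler_norm _) h.
have e0 k n : 0 < (2 ^+ k)^-1 / (2 ^ n.+1)%:R :> R.
  by rewrite divr_gt0// ?invr_gt0 ?exprn_gt0// ltr0n expn_gt0.
have [b bP] := @choice _ _ (fun (kn : nat * nat) c =>
  (P (A kn.2 c) <= ((2 ^+ kn.1)^-1 / (2 ^ kn.2.+1)%:R)%:E)%E)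
  (fun kn => A0 kn.2 _ (e0 kn.1 kn.2)).
exists (fun k n => b (k, n)).
pose K k := [set t | forall n, (f n t <= b (k, n))%N].
have KE k : K k = ~` \bigcup_n A n (b (k, n)).
  rewrite setC_bigcup; apply/seteqP; split=> [t h n _ /=|t h n].
    by apply/negP; rewrite -leqNgt; exact: h.
  by rewrite leqNgt; apply/negP; exact: (h n I).
have mU k : measurable (\bigcup_n A n (b (k, n))).
  by apply: bigcupT_measurable => n; exact: mf.
have mK k : measurable (K k) by rewrite KE; exact: measurableC.
have mUK : measurable (\bigcup_k K k) by exact: bigcupT_measurable.
pose C := ~` (\bigcup_k K k); rewrite -[LHS]/(P (\bigcup_k K k)).
rewrite -[X in P X]setCK -/C.
have mC : measurable C by exact: measurableC.
suff C0 : P C = 0 by apply: etrans (probability_setC P mC) _; rewrite C0 sube0.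
have Ck k : (P C <= ((2 ^+ k)^-1)%:E)%E.
  have CA : C `<=` \bigcup_n A n (b (k, n)).
    by move=> t /= Ct; apply: contrapT => h; apply: Ct; exists k => //; rewrite KE.
  have h := measure_sigma_subadditive P (fun n => mf n (b (k, n))) mC CA.
  apply: (le_trans h).
  apply: le_trans (epsilon_trick0 predT _); last by rewrite invr_ge0 exprn_ge0.
  by apply: lee_nneseries => // n _; exact: (bP (k, n)).
apply/eqP; rewrite eq_le measure_ge0 andbT.
apply/lee_addgt0Pr => e e_gt0; rewrite add0e.
have [k kP] : exists k : nat, (2 ^+ k)^-1 <= e :> R.
  exists (Num.truncn e^-1).+1; rewrite -[leRHS]invrK lef_pV2 ?posrE ?invr_gt0 ?exprn_gt0//.
  apply: ltW; apply: lt_trans (truncnS_gt _) _.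
  by rewrite -natrX ltr_nat ltn_expl.
by apply: le_trans (Ck k) _; rewrite lee_fin.
Qed.

Lemma probability_eq_off_null A B N : measurable A -> measurable B ->
  P.-negligible N -> (forall x, ~ N x -> A x <-> B x) -> P A = P B.
Proof.
move=> mA mB [N' [mN' N'0 NN']] AB.
suff le C C' : measurable C -> measurable C' ->
    (forall x, ~ N x -> C x -> C' x) -> (P C <= P C')%E.
  by apply/eqP; rewrite eq_le !le// => x nx; have [] := AB x nx.
move=> mC mC' CC'; apply: (@le_trans _ _ (P (C' `|` N'))).
  apply: le_measure; rewrite ?inE//; first exact: measurableU.
  move=> x Cx; have [nx|nx] := pselect (N x); first by right; exact: NN'.
  by left; exact: CC'.
have h : (P (C' `|` N') <= P C' + P N')%E by exact: measureU2.
by rewrite N'0 adde0 in h.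
Qed.

End bounded_integrals.

(** * Borel probability measures: equality and push-forward *)

Lemma eq_probability d (T : measurableType d) (R : realType)
  (mu nu : probability T R) : (mu = nu :> (set T -> \bar R)) -> mu = nu.
Proof.
case: mu nu => m1 c1 [m2 c2] /= E; subst m2; congr Probability.Pack.
(* Apart from the set function, the structures consist of proofs, which proof irrelevance
   identifies. *)
destruct c1 as [[a1 b1] [d1] [e1] [f1] [g1] [h1] [i1]].
destruct c2 as [[a2 b2] [d2] [e2] [f2] [g2] [h2] [i2]].
have ? := Prop_irrelevance a1 a2; have ? := Prop_irrelevance b1 b2.
subst.
have ? := Prop_irrelevance d1 d2; have ? := Prop_irrelevance e1 e2.
have ? := Prop_irrelevance f1 f2; have ? := Prop_irrelevance g1 g2.
have ? := Prop_irrelevance h1 h2; have ? := Prop_irrelevance i1 i2.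
by subst.
Qed.

Section borel.
Context (R : realType) (Y : topologicalType).

Lemma open_borel (h : [set: Y] !=set0) (U : set Y) : open U ->
  measurable (U : set (borel h)).
Proof. exact: sub_sigma_algebra. Qed.

Lemma closed_borel (h : [set: Y] !=set0) (U : set Y) : closed U ->
  measurable (U : set (borel h)).
Proof.
move=> cU; rewrite -[U]setCK; apply: measurableC; apply: open_borel.
exact: closed_openC.
Qed.

Lemma borel_measurability d (T : measurableType d) (h : [set: Y] !=set0)
  (f : T -> Y) : (forall U, open U -> measurable (f @^-1` U)) ->
  measurable_fun setT (f : T -> borel h).
Proof.
move=> mf.
apply: (@measurability _ _ T (borel h) setT f (borel_open h)) => //.
by move=> _ [B oB <-]; rewrite setTI; exact: mf.
Qed.

Lemma continuous_borel (h : [set: Y] !=set0) (f : Y -> R) : continuous f ->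
  measurable_fun setT (f : borel h -> R).
Proof.
move=> cf; apply: (@measurability _ _ _ _ _ _ (@RGenOpens.G R)).
  exact: RGenOpens.measurableE.
move=> _ [_ [a [b ->]] <-]; rewrite setTI; apply: open_borel.
by move/continuousP : cf; apply; exact: interval_open.
Qed.

Lemma Delta_ext (mu nu : Delta R Y) :
  (forall h (A : set (borel h)), measurable A -> mu A = nu A) -> mu = nu.
Proof.
case: mu nu => h mu mu0 [h' nu nu0] /= mn.
have hh : h' = h by exact: Prop_irrelevance.
subst h'.
have E : mu = nu.
  apply: eq_probability; apply/funext => A.
  have [mA|mA] := pselect (measurable A); first exact: (mn h).
  by rewrite mu0// nu0.
move: nu0 {mn}; rewrite -{}E => nu0.
by rewrite (Prop_irrelevance mu0 nu0).
Qed.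

(** Since open sets are countable unions of members of B, the family B generates the Borel sets;
    being closed under intersection, it is a pi-system, and the pi-lambda theorem applies. *)
Lemma Delta_eq_base (B : set (set Y)) (mu nu : Delta R Y) :
  B `<=` open -> setI_closed B ->
  (forall U : set Y, open U -> exists2 F : nat -> set Y,
    (forall n, B (F n) \/ F n = set0) & U = \bigcup_n F n) ->
  (forall A, B A -> mu A = nu A) -> mu = nu.
Proof.
move=> Bo BI BU mn; apply: Delta_ext => h A mA.
move: mn; case: mu nu => h1 mu mu0 [h2 nu nu0] /=.
have ? : h1 = h by exact: Prop_irrelevance.
have ? : h2 = h by exact: Prop_irrelevance.
subst h1 h2 => mn.
(* The uniqueness theorem wants generators of finite measure that cover the space, so the whole
   space is added, together with the empty set that may occur in the unions. *)
pose G : set (set (borel h)) := B `|` [set set0; setT].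
have mG : @measurable _ (borel h) = <<s G >>.
  apply/seteqP; split; apply: smallest_sub.
  - exact: smallest_sigma_algebra.
  - move=> U /BU[F BF ->]; apply: sigma_algebra_bigcup => n.
    apply: sub_gen_smallest; rewrite /G.
    by have [?|->] := BF n; [left|right; left].
  - exact: sigma_algebra_measurable.
  - move=> U [/Bo oU|[->|->]]; [exact: sub_gen_smallest| |].
    + exact: measurable0.
    + exact: measurableT.
apply: (@measure_unique _ R (borel h) G (fun=> setT)) => //.
- move=> U V [BU'|[->|->]]; last by rewrite setTI.
    move=> [BV|[->|->]]; first by left; exact: BI.
      by rewrite setI0; right; left.
    by rewrite setIT; left.
  by rewrite set0I => _; right; left.
- by move=> _; right; right.
- by rewrite bigcup_const//; exists 0%N.
- move=> U [/mn//|[->|->]]; first by rewrite !measure0.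
  exact: etrans (probability_setT mu) (esym (probability_setT nu)).
- move=> _; exact: le_lt_trans (probability_le1 mu measurableT) (ltry _).
Qed.

End borel.

Section push.
Context d (T : measurableType d) (R : realType) (P : probability T R).
Context (Y : topologicalType) (f : T -> Y).
Hypothesis mf : forall U, open U -> measurable (f @^-1` U).

Fact push_nonempty : [set: Y] !=set0.
Proof. by exists (f point). Qed.

Let h := push_nonempty.

Definition push_fun (A : set (borel h)) : \bar R :=
  if `[< measurable A >] then P (f @^-1` A) else 0%E.

Let push_preimage (A : set (borel h)) : measurable A -> measurable (f @^-1` A).
Proof.
by move=> mA; rewrite -[X in measurable X]setTI; exact: borel_measurability.
Qed.

Let push0 : push_fun set0 = 0%E.
Proof. by rewrite /push_fun asboolT// preimage_set0 measure0. Qed.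

Let push_ge0 A : (0 <= push_fun A)%E.
Proof. by rewrite /push_fun; case: ifP. Qed.

Let push_sigma_additive : semi_sigma_additive push_fun.
Proof.
move=> F mF tF mUF; rewrite /push_fun asboolT//.
under eq_fun do under eq_bigr do rewrite asboolT//.
rewrite preimage_bigcup; apply: measure_semi_sigma_additive.
- by move=> n; exact: push_preimage.
- apply/trivIsetP => /= i j _ _ ij; rewrite -preimage_setI.
  by move/trivIsetP : tF => /(_ _ _ _ _ ij) ->//; rewrite preimage_set0.
- by rewrite -preimage_bigcup; exact: push_preimage.
Qed.

HB.instance Definition _ := isMeasure.Build _ _ _ push_fun
  push0 push_ge0 push_sigma_additive.

Let pushT : push_fun setT = 1%E.
Proof. by rewrite /push_fun asboolT// preimage_setT probability_setT. Qed.

HB.instance Definition _ := Measure_isProbability.Build _ _ _ push_fun pushT.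

Fact push_out (A : set (borel h)) : ~ measurable A -> push_fun A = 0%E.
Proof. by move=> mA; rewrite /push_fun asboolF. Qed.

(** Unlike [Delta_map], this accepts a map that is only Borel, such as a quantile map or the passage
    from strategies to selected codes. *)
Definition Delta_push : Delta R Y := MkDelta push_out.

Lemma Delta_pushE (h' : [set: Y] !=set0) (A : set (borel h')) :
  measurable A -> Delta_push A = P (f @^-1` A).
Proof.
have ? : h' = h by exact: Prop_irrelevance.
by subst h' => mA; rewrite /Delta_push/= /push_fun asboolT.
Qed.

Lemma Rintegral_push (g : Y -> R) M : continuous g -> (forall y, `|g y| <= M) ->
  \int[Delta_push]_y g y = \int[P]_t g (f t).
Proof.
move=> cg gM; rewrite /Rintegral; congr fine.
have mg : measurable_fun setT (g : borel h -> R) by exact: continuous_borel.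
have mf' : measurable_fun setT (f : T -> borel h) by exact: borel_measurability.
rewrite -[RHS](@integral_pushforward _ _ _ _ _ _ mf' P setT (EFin \o g))//.
- apply: eq_measure_integral => A mA _.
  by rewrite /= /push_fun asboolT.
- exact/measurable_EFinP.
- have mgf : measurable_fun setT (g \o f) := measurableT_comp mg mf'.
  exact: (bounded_integrable P mgf (fun t => gM (f t))).
Qed.

End push.

(** * Weak convergence and continuity of image measures *)

Lemma bounded_fun_exP (R : realType) (T : Type) (f : T -> R) :
  bounded_fun f <-> exists M, forall x, `|f x| <= M.
Proof.
split=> [/pinfty_ex_gt0[M M0 fM]|[M fM]]; first by exists M => x; exact: fM.
apply: filterS (nbhs_pinfty_ge (num_real M)) => N MN x _.
exact: le_trans (fM x) MN.
Qed.

Lemma initial_topology_cvg (S : choiceType) (T : topologicalType) (f : S -> T)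
  (F : set_system S) (s : S) : Filter F -> f @ F --> f s ->
  F --> (s : initial_topology f).
Proof.
move=> FF fF A [_ [[B oB <-] Bfs BA]]; apply: filterS BA _.
by apply: fF; exact: open_nbhs_nbhs.
Qed.

Lemma prod_topology_cvgP (I : Type) (T : I -> topologicalType)
  (F : set_system (prod_topology T)) (p : prod_topology T) : Filter F ->
  F --> p <-> forall i, (fun q : prod_topology T => q i) @ F --> p i.
Proof.
move=> FF; split=> [Fp i|H].
  have := @initial_continuous _ _ (fun q : prod_topology T => q i) p.
  move/cvg_sup : Fp => /(_ i) Fp; apply: cvg_trans.
  exact: cvg_app.
by apply/cvg_sup => i; apply: initial_topology_cvg => //; exact: H.
Qed.

Section delta_map.
Context (R : realType).
Implicit Types X Y Z : topologicalType.

Lemma Delta_mapE X Y (f : X -> Y) (cf : continuous f) (mu : Delta R X)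
  (h : [set: Y] !=set0) (A : set (borel h)) :
  measurable A -> Delta_map cf mu A = mu (f @^-1` A).
Proof.
have ? : h = Delta_nonempty (Delta_map cf mu) by exact: Prop_irrelevance.
by subst h => mA; rewrite /Delta_map/= /image_fun asboolT.
Qed.

Lemma Delta_preimage X Y (f : X -> Y) (cf : continuous f)
  (hX : [set: X] !=set0) (hY : [set: Y] !=set0) (A : set (borel hY)) :
  measurable A -> measurable (f @^-1` A : set (borel hX)).
Proof.
move=> mA; rewrite -[X in measurable X]setTI.
apply: (borel_measurability (T := borel hX)) => // U oU.
by apply: open_borel; move/continuousP : cf; apply.
Qed.

Lemma Rintegral_map X Y (f : X -> Y) (cf : continuous f) (mu : Delta R X)
  (g : Y -> R) M : (forall h, measurable_fun setT (g : borel h -> R)) ->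
  (forall y, `|g y| <= M) ->
  \int[Delta_map cf mu]_y g y = \int[mu]_x g (f x).
Proof.
move=> mg gM; rewrite /Rintegral; congr fine.
pose hY := Delta_nonempty (Delta_map cf mu).
have mf : measurable_fun setT (f : borel (Delta_nonempty mu) -> borel hY).
  by move=> _ A mA; rewrite setTI; exact: Delta_preimage.
have mgf : measurable_fun setT (g \o f : borel (Delta_nonempty mu) -> R).
  exact: (measurableT_comp (mg hY) mf).
rewrite -[RHS](@integral_pushforward _ _ _ _ _ _ mf mu setT (EFin \o g))//.
- by apply: eq_measure_integral => A mA _; exact: Delta_mapE.
- exact/measurable_EFinP.
- exact: (bounded_integrable mu mgf (fun t => gM (f t))).
Qed.

Lemma Delta_map_comp X Y Z (f : X -> Y) (g : Y -> Z) (k : X -> Z)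
  (cf : continuous f) (cg : continuous g) (ck : continuous k) (mu : Delta R X) :
  (forall x, g (f x) = k x) -> Delta_map cg (Delta_map cf mu) = Delta_map ck mu.
Proof.
move=> gfk; apply: Delta_ext => h A mA.
have mgA := @Delta_preimage _ _ _ cg (Delta_nonempty (Delta_map cf mu)) _ _ mA.
rewrite (Delta_mapE ck mu mA) (Delta_mapE cg _ mA) (Delta_mapE cf mu mgA).
by congr (mu _); apply/funext => x; rewrite /preimage/= gfk.
Qed.

Lemma Delta_cvgP Y (F : set_system (Delta R Y)) (mu : Delta R Y) : Filter F ->
  F --> mu <-> forall f : Y -> R, continuous f -> bounded_fun f ->
    (fun nu : Delta R Y => \int[nu]_y f y) @ F --> \int[mu]_y f y.
Proof.
move=> FF; split=> [Fmu f cf bf|H].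
  have cE := @initial_continuous _ _ (@Delta_eval R Y) mu.
  have /prod_topology_cvgP h : @Delta_eval R Y @ F --> @Delta_eval R Y mu.
    by apply: cvg_trans cE; exact: cvg_app.
  exact: (h (exist _ f (conj cf bf))).
apply: initial_topology_cvg; apply/prod_topology_cvgP => -[f [cf bf]].
exact: H.
Qed.

Lemma Rintegral_continuous Y (f : Y -> R) : continuous f -> bounded_fun f ->
  continuous (fun nu : Delta R Y => \int[nu]_y f y).
Proof.
move=> cf bf mu; have /Delta_cvgP h : nbhs mu --> mu by [].
exact: h.
Qed.

Lemma Delta_map_continuous X Y (f : X -> Y) (cf : continuous f) :
  continuous (@Delta_map R X Y f cf).
Proof.
move=> mu; have FF : Filter (Delta_map cf @ nbhs mu) by exact: fmap_filter.
apply/Delta_cvgP => g cg /[dup] bg /bounded_fun_exP[M gM].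
have E nu : \int[Delta_map cf nu]_y g y = \int[nu]_x (g \o f) x.
  by rewrite (Rintegral_map _ _ (M := M))// => h; exact: continuous_borel.
rewrite E -[X in X --> _]/((fun nu => \int[Delta_map cf nu]_y g y) @ nbhs mu).
under eq_fun do rewrite E.
apply: Rintegral_continuous.
  by move=> x; apply: continuous_comp; [exact: cf|exact: cg].
by apply/bounded_fun_exP; exists M => x; exact: gM.
Qed.

End delta_map.

(** * Polish metrics and countable families of bump functions *)

Definition polish_metric (R : realType) (X : topologicalType) (d : X -> X -> R)
    (e : nat -> X) : Prop :=
  [/\ [/\ forall x y, 0 <= d x y,
          forall x y, d x y = 0 <-> x = y,
          forall x y, d x y = d y x
        & forall x y z, d x z <= d x y + d y z],
      forall (x : X) (A : set X),
        nbhs x A <-> exists2 e : R, 0 < e & [set y | d x y < e] `<=` A,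
      forall u : nat -> X,
        (forall e : R, 0 < e ->
           exists N, forall m n, (N <= m)%N -> (N <= n)%N -> d (u m) (u n) < e) ->
        exists l : X, u n @[n --> \oo] --> l
    & forall x r, 0 < r -> exists n, d (e n) x < r].

Lemma polish_metricP (R : realType) (X : topologicalType) : polish R X ->
  [set: X] !=set0 -> exists d e, @polish_metric R X d e.
Proof.
move=> [[D cD dD] [d [dm dn dc]]] [x0 _].
have [D0|D0] := eqVneq D set0.
  by have := dD setT (ex_intro _ x0 I) openT; rewrite D0 setI0 => -[].
have /set0P[a Da] := D0.
have [e De] : exists e : nat -> X, D `<=` range e.
  have /countable_injP[f fD] := cD.
  exists (fun n => xget a [set y | D y /\ f y = n]) => y Dy; exists (f y) => //.
  case: xgetP => [z _ [Dz /fD]|/(_ y)[]//].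
  by rewrite !inE => /(_ Dz Dy).
exists d, e; split=> // x r r0.
have : nbhs x [set y | d x y < r] by apply/dn; exists r.
rewrite nbhsE => -[U [oU Ux] UB].
have [y [/UB/= xy /De[n _ ny]]] := dD U (ex_intro _ x Ux) oU.
by exists n; rewrite ny; have [_ _ -> _] := dm.
Qed.

Section metric.
Context (R : realType) (X : topologicalType) (d : X -> X -> R) (e : nat -> X).
Hypothesis dP : polish_metric d e.

Lemma dist_ge0 x y : 0 <= d x y. Proof. by have [[]] := dP. Qed.
Lemma dist0 x y : d x y = 0 -> x = y.
Proof. by have [[_ h _ _] _ _ _] := dP; move/h. Qed.
Lemma dist_sym x y : d x y = d y x. Proof. by have [[]] := dP. Qed.
Lemma dist_triangle y x z : d x z <= d x y + d y z. Proof. by have [[]] := dP. Qed.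

Lemma nbhs_ball_dist x r : 0 < r -> nbhs x [set y | d x y < r].
Proof. by move=> r0; have [_ h _ _] := dP; apply/h; exists r. Qed.

Lemma nbhs_distP x A : nbhs x A -> exists2 r, 0 < r & [set y | d x y < r] `<=` A.
Proof. by have [_ h _ _] := dP; move/h. Qed.

Lemma dense_dist x r : 0 < r -> exists n, d (e n) x < r.
Proof. by have [_ _ _ h] := dP; exact: h. Qed.

Lemma dist_continuous a : continuous (d a).
Proof.
move=> x; apply/cvgrPdist_lt => r r0; near=> y.
have xy : d x y < r by near: y; exact: nbhs_ball_dist.
have := dist_triangle x a y; have := dist_triangle y a x.
by rewrite (dist_sym y x) ltr_norml; lra.
Unshelve. all: end_near. Qed.

Lemma dist_hausdorff : hausdorff_space X.
Proof.
move=> x y xy; apply: dist0; apply/eqP; rewrite eq_le dist_ge0 andbT leNgt.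
apply/negP => d0; have d2 : 0 < d x y / 2 by rewrite divr_gt0.
have [z [/= xz yz]] := xy _ _ (nbhs_ball_dist x d2) (nbhs_ball_dist y d2).
have := dist_triangle z x y; rewrite (dist_sym z y); lra.
Qed.

End metric.

(** Stands in for separable metrizability. It yields a countable base, makes continuous functions
    separate measures, and passes to products and to [Delta]; thus it reaches every level of the
    hierarchy without a metric for the weak topology. *)
Definition bumpable (R : realType) (Y : topologicalType) : Prop :=
  exists g : nat -> Y -> R,
    [/\ forall n, continuous (g n),
        forall n y, 0 <= g n y <= 1
      & forall y U, nbhs y U ->
          exists n, g n y = 1 /\ forall z, 0 < g n z -> U z].

Definition clip (R : realType) (t : R) : R := Num.max 0 (Num.min 1 t).

Section clip.
Context (R : realType).
Implicit Type t : R.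

Lemma clip_continuous : continuous (@clip R).
Proof.
move=> t; apply: (@continuous_max _ _ (cst 0)); first exact: cvg_cst.
by apply: (@continuous_min _ _ (cst 1) id); [exact: cvg_cst|exact: cvg_id].
Qed.

Lemma clip01 t : 0 <= clip t <= 1.
Proof. by rewrite /clip le_max lexx /= ge_max ler01 ge_min lexx. Qed.

Lemma clip1 t : 1 <= t -> clip t = 1.
Proof.
by move=> t1; rewrite /clip (min_idPl t1); apply/max_idPr; exact: ler01.
Qed.

Lemma clip_gt0 t : 0 < clip t -> 0 < t.
Proof. by rewrite /clip lt_max ltxx/= lt_min => /andP[]. Qed.

End clip.

Lemma continuous_snd (Y Z : topologicalType) : continuous (@snd Y Z).
Proof. by move=> x; exact: cvg_snd. Qed.

Lemma bumpable_prod (R : realType) (Y Z : topologicalType) :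
  bumpable R Y -> bumpable R Z -> bumpable R (Y * Z)%type.
Proof.
move=> [g [cg g01 gU]] [h [ch h01 hU]].
pose c n : nat * nat := odflt (0%N, 0%N) (unpickle n).
exists (fun n p => g (c n).1 p.1 * h (c n).2 p.2); split.
- move=> n p; apply: cvgM.
  + exact: (continuous_comp (@continuous_fst Y Z p) (cg _ _)).
  + exact: (continuous_comp (@continuous_snd Y Z p) (ch _ _)).
- move=> n p; have /andP[g0 g1] := g01 (c n).1 p.1.
  have /andP[h0 h1] := h01 (c n).2 p.2.
  by rewrite mulr_ge0//= mulr_ile1.
- move=> [y z] U [[A B] /= [yA zB] ABU].
  have [n [gn gA]] := gU _ _ yA; have [m [hm hB]] := hU _ _ zB.
  exists (pickle (n, m)); rewrite /c pickleK/= gn hm mulr1; split=> // -[a b] /=.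
  have /andP[g0 _] := g01 n a; have /andP[h0 _] := h01 m b.
  move=> gh; apply: ABU; split=> /=; [apply: gA|apply: hB].
    by rewrite lt_neqAle g0 andbT eq_sym; apply/eqP => g0'; rewrite g0' mul0r ltxx in gh.
  by rewrite lt_neqAle h0 andbT eq_sym; apply/eqP => h0'; rewrite h0' mulr0 ltxx in gh.
Qed.

Lemma bumpable_polish (R : realType) (X : topologicalType) :
  polish R X -> bumpable R X.
Proof.
move=> pX; have [[x0 _]|X0] := pselect ([set: X] !=set0); last first.
  by exists (fun _ _ => 0); split=> [n y|n y|y]; case: X0; exists y.
have [d [e dP]] := polish_metricP pX (ex_intro _ x0 I).
pose c n : nat * nat := odflt (0%N, 0%N) (unpickle n).
exists (fun n y => clip (2 - (c n).2%:R * d (e (c n).1) y)); split.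
- move=> n y; apply: (cvg_comp _ (@clip R)); last exact: clip_continuous.
  apply: cvgB; first exact: cvg_cst.
  by apply: cvgM; [exact: cvg_cst|exact: (dist_continuous dP)].
- by move=> n y; exact: clip01.
- move=> y U /(nbhs_distP dP)[r r0 rU].
  (* The bump at a centre is 1 within 1/k of it and vanishes from 2/k on. With the centre within 1/k
     of y, the points where the bump is positive are within 3/k < r of y. *)
  have [k kr] : exists k : nat, 3 < k%:R * r.
    exists (Num.truncn (3 / r)).+1.
    by rewrite -ltr_pdivrMr// truncnS_gt.
  have k0 : 0 < k%:R :> R.
    by rewrite ltNge; apply/negP => k0; nra.
  have [n nk] : exists n, d (e n) y < k%:R^-1 by apply: (dense_dist dP); rewrite invr_gt0.
  exists (pickle (n, k)); rewrite /c pickleK/=; split.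
    apply: clip1; have : k%:R * d (e n) y < 1 by rewrite mulrC -ltr_pdivlMr// div1r.
    lra.
  move=> z /clip_gt0 z0; apply: rU => /=.
  have := dist_triangle dP (e n) y z; rewrite (dist_sym dP y (e n)) => dyz.
  rewrite -(ltr_pM2l k0); apply: lt_trans kr.
  have : k%:R * d (e n) y < 1 by rewrite mulrC -ltr_pdivlMr// div1r.
  have : k%:R * d y z <= k%:R * (d (e n) y + d (e n) z) by rewrite ler_pM2l.
  rewrite mulrDr; lra.
Qed.

(** * A countable family of tests for the weak topology *)

Section weak_topology.
Context (R : realType) (Y : topologicalType) (g : nat -> Y -> R).
Hypothesis cg : forall n, continuous (g n).
Hypothesis g01 : forall n y, 0 <= g n y <= 1.
Hypothesis gU : forall y U, nbhs y U ->
  exists n, g n y = 1 /\ forall z, 0 < g n z -> U z.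

(** Rational coefficients keep these functions countable in number, while their maxima approximate
    nonnegative continuous functions from below. *)
Definition hat (l : seq (nat * rat)) (y : Y) : R :=
  foldr (fun p m => Num.max (ratr p.2 * g p.1 y) m) 0 l.

Lemma hat_continuous l : continuous (hat l).
Proof.
elim: l => [|p l IH] y; first exact: cvg_cst.
apply: (@continuous_max _ _ (fun y => ratr p.2 * g p.1 y) (hat l)); last exact: IH.
by apply: cvgM; [exact: cvg_cst|exact: cg].
Qed.

Lemma hat_ge0 l y : 0 <= hat l y.
Proof. by elim: l => //= p l IH; rewrite le_max IH orbT. Qed.

Lemma hat_bounded l : exists M, forall y, `|hat l y| <= M.
Proof.
suff [M h] : exists M, forall y, hat l y <= M.
  by exists M => y; rewrite ger0_norm ?hat_ge0.
elim: l => [|p l [M h]]; first by exists 0.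
exists (Num.max `|ratr p.2| M) => y /=; rewrite ge_max !le_max h orbT andbT.
apply/orP; left; have /andP[g0 g1] := g01 p.1 y.
apply: le_trans (ler_norm _) _; rewrite normrM ler_piMr//.
by rewrite ger0_norm.
Qed.

Lemma hat_le f l y : (forall p, p \in l -> ratr p.2 * g p.1 y <= f y) ->
  0 <= f y -> hat l y <= f y.
Proof.
move=> + f0; elim: l => //= p l IH h; rewrite ge_max h ?mem_head//=.
by apply: IH => q ql; apply: h; rewrite inE ql orbT.
Qed.

Lemma hat_ge l p y : p \in l -> ratr p.2 * g p.1 y <= hat l y.
Proof.
elim: l => //= q l IH; rewrite inE le_max => /orP[/eqP->|/IH ->].
  by rewrite lexx.
by rewrite orbT.
Qed.

(** Enumerate the rational multiples of bumps that lie below f. If q < f y, some bump equals 1 at y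
    and is positive only where q < f, so its q-multiple is on the list. The maxima of initial
    segments thus converge pointwise to f, and dominated convergence gives the integrals. *)
Lemma hat_approx (f : Y -> R) M (mu : Delta R Y) r : continuous f ->
  (forall y, 0 <= f y <= M) -> 0 < r ->
  exists l, (forall y, hat l y <= f y) /\
    \int[mu]_y f y - r < \int[mu]_y hat l y.
Proof.
move=> cf f0M r0.
pose l N : seq (nat * rat) := [seq p <- pmap unpickle (iota 0 N) |
  `[< forall y, ratr p.2 * g p.1 y <= f y >]].
have lf N y : hat (l N) y <= f y.
  have /andP[f0 _] := f0M y; apply: hat_le => // p.
  by rewrite mem_filter => /andP[/asboolP].
have cvl y : hat (l N) y @[N --> \oo] --> f y.
  apply/cvgrPdist_lt => s s0; have /andP[f0 _] := f0M y.
  have [fs|fs] := ltP (f y) s.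
    near=> N; have := lf N y; have := hat_ge0 (l N) y.
    by rewrite ltr_norml; lra.
  have : f y - s < f y by lra.
  move=> /rat_in_itvoo[q]; rewrite in_itv/= => /andP[q1 q2].
  have : nbhs y [set z | ratr q < f z] by apply: (cvgr_gt _ (cf y)).
  move=> /gU[n [gn gq]].
  have qf z : ratr q * g n z <= f z.
    have /andP[g0 g1] := g01 n z; have /andP[f0' _] := f0M z.
    have [z0|z0] := ltP 0 (g n z); last first.
      have -> : g n z = 0 by lra.
      by rewrite mulr0.
    have /= := gq _ z0; nra.
  near=> N.
  have pl : (n, q) \in l N.
    rewrite mem_filter; apply/andP; split; first exact/asboolP.
    rewrite mem_pmap; apply/mapP; exists (pickle (n, q)); last by rewrite pickleK.
    by rewrite mem_iota add0n /=; near: N; exact: nbhs_infty_gt.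
  have := hat_ge y pl; have := lf N y; rewrite /= gn mulr1 ltr_norml; lra.
have : \int[mu]_y hat (l N) y @[N --> \oo] --> \int[mu]_y f y.
  apply: (@dominated_Rintegral _ _ _ mu _ _ M).
  - by move=> N; apply: continuous_borel; exact: hat_continuous.
  - exact: continuous_borel.
  - move=> N y; rewrite ger0_norm ?hat_ge0//.
    by apply: le_trans (lf N y) _; have /andP[] := f0M y.
  - by apply: aeW => y; exact: cvl.
move=> /cvgrPdist_lt/(_ _ r0)[N _ /(_ N (leqnn N))] /=.
by rewrite ltr_norml => h; exists (l N); split=> //; lra.
Unshelve. all: end_near. Qed.

(* An entry (l, c, k) is the test function that is 1 when int (hat l) is at least
   c + 1/k and 0 when it is at most c. *)
Definition tests (L : seq (seq (nat * rat) * rat * nat)) (mu : Delta R Y) : R :=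
  foldr (fun t m => clip (t.2%:R * (\int[mu]_y hat t.1.1 y - ratr t.1.2)) * m) 1 L.

Lemma tests_continuous L : continuous (tests L).
Proof.
elim: L => [|t L IH] mu; first exact: (@cst_continuous _ _ (1 : R)).
pose a (nu : Delta R Y) : R := t.2%:R * (\int[nu]_y hat t.1.1 y - ratr t.1.2).
have ca : continuous a.
  move=> nu; have ch : continuous (fun nu : Delta R Y => \int[nu]_y hat t.1.1 y).
    apply: Rintegral_continuous; first exact: hat_continuous.
    by apply/bounded_fun_exP; exact: hat_bounded.
  have c1 : continuous (fun nu : Delta R Y => \int[nu]_y hat t.1.1 y - ratr t.1.2).
    move=> nu'; apply: (@cvgB _ _ (Delta R Y) (nbhs nu') _
      (fun nu : Delta R Y => \int[nu]_y hat t.1.1 y) (cst (ratr t.1.2))).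
      exact: ch.
    exact: cvg_cst.
  exact: (cvgM (@cvg_cst R t.2%:R (Delta R Y) (nbhs nu) _) (c1 nu)).
exact: (cvgM (cvg_comp a (@clip R) (ca mu) (@clip_continuous R _)) (IH mu)).
Qed.

Lemma tests01 L mu : 0 <= tests L mu <= 1.
Proof.
elim: L => /= [|t L /andP[h0 h1]]; first by rewrite ler01 lexx.
have /andP[c0 c1] := clip01 (t.2%:R * (\int[mu]_y hat t.1.1 y - ratr t.1.2)).
by rewrite mulr_ge0//= mulr_ile1.
Qed.

Lemma tests_cat L L' mu : tests (L ++ L') mu = tests L mu * tests L' mu.
Proof. by elim: L => /= [|t L ->]; rewrite ?mul1r// mulrA. Qed.

Definition tests_nbhs (mu : Delta R Y) : set_system (Delta R Y) :=
  [set U | exists L, tests L mu = 1 /\ forall nu, 0 < tests L nu -> U nu].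

Lemma tests_nbhs_filter mu : Filter (tests_nbhs mu).
Proof.
split.
- by exists [::].
- move=> U V [L [L1 LU]] [L' [L1' LV]]; exists (L ++ L').
  rewrite tests_cat L1 L1' mulr1; split=> // nu; rewrite tests_cat.
  have /andP[h0 _] := tests01 L nu; have /andP[h0' _] := tests01 L' nu.
  move=> h; split; [apply: LU|apply: LV]; rewrite lt_neqAle ?h0 ?h0' andbT;
    apply/eqP => z; move: h; by rewrite -z ?mul0r ?mulr0 ltxx.
- by move=> U V UV [L [L1 LU]]; exists L; split=> // nu /LU; exact: UV.
Qed.

(** A lower bound on the integral of a hat below f + M is inherited by f + M, so one test suffices.
    Upper bounds come from the same statement for - f. *)
Lemma tests_nbhs_gt mu (f : Y -> R) (M r : R) : continuous f ->
  (forall y, `|f y| <= M) -> 0 < r ->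
  tests_nbhs mu [set nu : Delta R Y | \int[mu]_y f y - r < \int[nu]_y f y].
Proof.
move=> cf fM r0; pose f' y := f y + M.
have M0 : 0 <= M by have [y _] := Delta_nonempty mu; exact: le_trans (fM y).
have cf' : continuous f' by move=> y; apply: cvgD; [exact: cf|exact: cvg_cst].
have f'0 y : 0 <= f' y <= M + M.
  by have := fM y; rewrite ler_norml /f'; lra.

have E (nu : Delta R Y) : \int[nu]_y f' y = \int[nu]_y f y + M.
  rewrite RintegralD//.
  - by congr (_ + _); exact: Rintegral_prob_cst.
  - exact: (bounded_integrable nu (continuous_borel cf) fM).
  - exact: finite_measure_integrable_cst.
have r2 : 0 < r / 2 by lra.
have [l [lf]] := hat_approx mu cf' f'0 r2; rewrite E => lr.
have : \int[mu]_y f y + M - r < \int[mu]_y hat l y by lra.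
move=> /rat_in_itvoo[q]; rewrite in_itv/= => /andP[q1 q2].
have s0 : 0 < \int[mu]_y hat l y - ratr q by lra.
(* Steep enough for the test to reach 1 at mu; at any nu where it is positive the integral of the
   hat exceeds q. *)
pose k := (Num.truncn (\int[mu]_y hat l y - ratr q)^-1).+1.
exists [:: (l, q, k)]; split=> [|nu] /=; rewrite mulr1.
  apply: clip1; rewrite -ler_pdivrMr// div1r ltW//; exact: truncnS_gt.
move=> /clip_gt0; rewrite pmulr_rgt0// => h.
suff : \int[nu]_y hat l y <= \int[nu]_y f' y by rewrite E; lra.
have [Ml hM] := hat_bounded l.
apply: le_Rintegral => //.
- exact: (bounded_integrable nu (continuous_borel (@hat_continuous l)) hM).
- apply: (bounded_integrable nu (continuous_borel cf') (M := M + M)) => y.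
  by have /andP[? ?] := f'0 y; rewrite ger0_norm.
Qed.

Lemma tests_nbhs_cvg mu : tests_nbhs mu --> mu.
Proof.
have FF := tests_nbhs_filter mu.
apply/Delta_cvgP => f cf /bounded_fun_exP[M fM]; apply/cvgrPdist_lt => r r0.
have cNf : continuous (fun y => - f y) by move=> y; apply: cvgN; exact: cf.
have NfM y : `|- f y| <= M by rewrite normrN.
have EN (nu : Delta R Y) : \int[nu]_y (- f y) = - \int[nu]_y f y.
  under eq_Rintegral do rewrite -mulN1r.
  rewrite RintegralZl ?mulN1r//.
  exact: (bounded_integrable nu (continuous_borel cf) fM).
apply: filterS2 (tests_nbhs_gt mu cf fM r0) (tests_nbhs_gt mu cNf NfM r0).
by move=> nu /=; rewrite !EN ltr_norml; lra.
Qed.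

End weak_topology.

Lemma bumpable_Delta (R : realType) (Y : topologicalType) :
  bumpable R Y -> bumpable R (Delta R Y).
Proof.
move=> [g [cg g01 gU]].
exists (fun n => tests g (odflt [::] (unpickle n))); split.
- by move=> n; exact: tests_continuous.
- by move=> n mu; exact: tests01.
- move=> mu U /(tests_nbhs_cvg cg g01 gU)[L [L1 LU]].
  by exists (pickle L); rewrite pickleK.
Qed.

Lemma bumpable_level (R : realType) (X : bool -> topologicalType) :
  (forall i, polish R (X i)) -> forall n i, bumpable R (level R X n i).
Proof.
move=> pX; elim=> [|n IH] i /=; first exact/bumpable_polish.
by apply: bumpable_prod; [exact: IH|exact: bumpable_Delta].
Qed.

(** * Hausdorff separation of measures, hierarchies and types *)

Lemma separated_hausdorff (Y : topologicalType) :
  (forall x y : Y, x <> y -> exists (Z : topologicalType) (f : Y -> Z),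
    [/\ continuous f, hausdorff_space Z & f x <> f y]) -> hausdorff_space Y.
Proof.
move=> sep x y xy; apply: contrapT => /sep[Z [f [cf hZ fxy]]].
apply: fxy; apply: hZ => A B fxA fyB.
by have [z [Az Bz]] := xy _ _ (cf _ _ fxA) (cf _ _ fyB); exists (f z).
Qed.

Lemma hausdorff_pair (Y Z : topologicalType) :
  hausdorff_space Y -> hausdorff_space Z -> hausdorff_space (Y * Z)%type.
Proof.
move=> hY hZ; apply: separated_hausdorff => -[y z] [y' z'] ne.
have [yy|yy] := pselect (y = y').
  exists Z, snd; split; [exact: continuous_snd|by []|] => /= zz.
  by apply: ne; rewrite yy zz.
by exists Y, fst; split=> //; exact: continuous_fst.
Qed.

Section bumpable_consequences.
Context (R : realType) (Y : topologicalType).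
Hypothesis bY : bumpable R Y.

Lemma bumpable_base : exists V : nat -> set Y, (forall n, open (V n)) /\
  forall U y, open U -> U y -> exists n, V n y /\ V n `<=` U.
Proof.
have [g [cg g01 gU]] := bY.
exists (fun n => [set y | 0 < g n y]); split=> [n|U y oU Uy].
  have /continuousP cgn := cg n.
  by apply: (cgn [set t | 0 < t]); exact: open_gt.
have [n [gn gnU]] := gU y U (open_nbhs_nbhs (conj oU Uy)).
by exists n; split; [rewrite /= gn ltr01|exact: gnU].
Qed.

(** The indicator of an open set U is the pointwise limit of maxima of finitely many bumps supported
    in U, so integrals of continuous functions determine the measure of U. *)
Lemma bumpable_Delta_eq (mu nu : Delta R Y) :
  (forall f : Y -> R, continuous f -> bounded_fun f ->
    \int[mu]_y f y = \int[nu]_y f y) -> mu = nu.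
Proof.
have [g [cg g01 gU]] := bY => mn.
apply: (@Delta_eq_base _ _ open) => //.
- by move=> A B; exact: openI.
- by move=> U oU; exists (fun=> U); [left|rewrite bigcup_const//; exists 0%N].
move=> U oU.
pose l N : seq (nat * rat) := [seq (n, 1%Q) | n <- iota 0 N
  & `[< [set y | 0 < g n y] `<=` U >]].
have lN1 N y : hat g (l N) y <= \1_U y.
  apply: hat_le; last by rewrite indicE ler0n.
  move=> p /mapP[n]; rewrite mem_filter => /andP[/asboolP nU _] -> /=.
  rewrite rmorph1 mul1r indicE; have /andP[g0 g1] := g01 n y.
  have [z0|z0] := ltP 0 (g n y); first by rewrite mem_set//; exact: nU.
  exact: le_trans z0 (ler0n _ _).
have cvl y : hat g (l N) y @[N --> \oo] --> (\1_U y : R).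
  apply: cvg_near_cst; have [Uy|Uy] := pselect (U y); last first.
    near=> N; apply/eqP; rewrite eq_le lN1/= indicE memNset//.
    exact: hat_ge0.
  have [n [gn nU]] := gU y U (open_nbhs_nbhs (conj oU Uy)).
  near=> N; apply/eqP; rewrite eq_le lN1/= indicE mem_set//= -gn.
  suff /(hat_ge g y) : (n, 1%Q) \in l N by rewrite /= rmorph1 mul1r.
  apply/mapP; exists n => //; rewrite mem_filter; apply/andP; split.
    by apply/asboolP; exact: nU.
  by rewrite mem_iota add0n /=; near: N; exact: nbhs_infty_gt.
have cvE (ka : Delta R Y) :
    \int[ka]_y hat g (l N) y @[N --> \oo] --> fine (ka U).
  have mU : measurable (U : set (borel (Delta_nonempty ka))) by exact: open_borel.
  have -> : fine (ka U) = \int[ka]_y (\1_U y : R).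
    by rewrite /Rintegral integral_indic// setIT.
  apply: (@dominated_Rintegral _ _ _ ka _ _ 1).
  - by move=> N; apply: continuous_borel; exact: hat_continuous.
  - exact: measurable_indic.
  - move=> N y; rewrite ger0_norm ?hat_ge0//; apply: le_trans (lN1 _ _) _.
    by rewrite indicE; case: (_ \in _).
  - by apply: aeW => y; exact: cvl.
have mE N : \int[mu]_y hat g (l N) y = \int[nu]_y hat g (l N) y.
  apply: mn; first exact: hat_continuous.
  by apply/bounded_fun_exP; exact: hat_bounded.
have := cvE mu; under eq_fun do rewrite mE; move=> cm.
have E : fine (mu U) = fine (nu U).
  by apply: (cvg_unique _ cm (cvE nu)); exact: Rhausdorff.
have fm (ka : Delta R Y) : ka U \is a fin_num.
  have mU : measurable (U : set (borel (Delta_nonempty ka))) by exact: open_borel.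
  exact: (fin_num_measure ka _ mU).
rewrite -(fineK (fm mu)) -(fineK (fm nu)); exact: (congr1 EFin E).
Unshelve. all: end_near. Qed.

Lemma hausdorff_Delta : hausdorff_space (Delta R Y).
Proof.
apply: separated_hausdorff => mu nu ne.
have [f [cf bf fmn]] : exists f : Y -> R, [/\ continuous f, bounded_fun f &
    \int[mu]_y f y <> \int[nu]_y f y].
  apply: contrapT => H; apply: ne; apply: bumpable_Delta_eq => f cf bf.
  by apply: contrapT => ne; apply: H; exists f.
exists R, (fun ka : Delta R Y => \int[ka]_y f y); split=> //.
exact: Rintegral_continuous.
Qed.

End bumpable_consequences.

Lemma hausdorff_polish (R : realType) (X : topologicalType) :
  polish R X -> hausdorff_space X.
Proof.
move=> pX x; have [d [e dP]] := polish_metricP pX (ex_intro _ x I).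
exact: (dist_hausdorff dP).
Qed.

Section hausdorff_types.
Context (R : realType) (X : bool -> topologicalType).
Hypothesis pX : forall i, polish R (X i).

Lemma hausdorff_hierarchy i : hausdorff_space (hierarchy R X i).
Proof.
apply: separated_hausdorff => p q ne.
have [n pqn] : exists n, p n <> q n.
  apply: contrapT => H; apply: ne; apply: functional_extensionality_dep => n.
  by apply: contrapT => ne; apply: H; exists n.
exists (Delta R (level R X n i)), (fun p : hierarchy R X i => p n); split=> //.
  exact: (@proj_continuous nat (fun n => Delta R (level R X n i)) n).
exact/hausdorff_Delta/bumpable_level.
Qed.

Lemma hausdorff_types i : hausdorff_space (types R X i).
Proof.
apply: separated_hausdorff => p q ne.
exists (hierarchy R X i), set_val; split.
- exact: initial_continuous.
- exact: hausdorff_hierarchy.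
- by move/val_inj.
Qed.

End hausdorff_types.

(** * Full measure and the transfinite elimination *)

Lemma full_measureP (R : realType) (X : topologicalType) (mu : Delta R X)
    (S : set X) : full_measure mu S <->
  exists A : set (borel (Delta_nonempty mu)),
    [/\ measurable A, A `<=` S & mu A = 1%E].
Proof.
split=> [[A [N [mA _ -> muA]]]|[A [mA AS muA]]].
  by exists A; split=> // x; left.
exists A, (S `\` A); split=> //; last first.
  by rewrite setDE setUIr setUCr setIT setUidr.
exists (~` A); split; [exact: measurableC| |by move=> x []].
by rewrite probability_setC// muA subee.
Qed.

Lemma full_measureS (R : realType) (X : topologicalType) (mu : Delta R X)
  (S S' : set X) : S `<=` S' -> full_measure mu S -> full_measure mu S'.
Proof.
move=> SS' /full_measureP[A [mA AS muA]]; apply/full_measureP.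
by exists A; split=> //; exact: subset_trans SS'.
Qed.

Section elimination.
Context (R : realType) (X : bool -> topologicalType).
Variable pi : bool -> X false * X true -> R.

Local Notation strategies := (forall i, set (X i)).
Local Notation elim := (eliminate pi).

Definition sub_strategies (S S' : strategies) := forall i, S i `<=` S' i.
Local Notation "S `<<=` S'" := (sub_strategies S S') (at level 70).

Lemma strategies_ext (S S' : strategies) : S `<<=` S' -> S' `<<=` S -> S = S'.
Proof.
move=> SS' S'S; apply: functional_extensionality_dep => i.
by apply/seteqP; split; [exact: SS'|exact: S'S].
Qed.

Lemma eliminate_sub S : elim S `<<=` S.
Proof. by move=> i s []. Qed.

Lemma eliminate_mono S S' : S `<<=` S' -> elim S `<<=` elim S'.
Proof.
move=> SS' i s [Ss [mu muS br]]; split; first exact: SS'.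
by exists mu => //; apply: full_measureS muS; exact: SS'.
Qed.

Definition meet (F : set strategies) : strategies :=
  fun i => [set s | forall S, F S -> S i s].

Lemma meet_sub (F : set strategies) S : F S -> meet F `<<=` S.
Proof. by move=> FS i s; exact. Qed.

Lemma sub_meet (F : set strategies) S :
  (forall S', F S' -> S `<<=` S') -> S `<<=` meet F.
Proof. by move=> SF i s Ss S' /SF; exact. Qed.

(* The tower of all stages; reverse inclusion well-orders it. *)
Definition stage (S : strategies) : Prop :=
  forall C : set strategies, (forall S, C S -> C (elim S)) ->
    (forall F, F `<=` C -> C (meet F)) -> C S.

Lemma stage_eliminate S : stage S -> stage (elim S).
Proof. by move=> sS C CE CM; exact: CE (sS C CE CM). Qed.

Lemma stage_meet F : F `<=` stage -> stage (meet F).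
Proof. by move=> sF C CE CM; apply: (CM) => S /sF sS; exact: (sS C CE CM). Qed.

Lemma stage_ind (C : set strategies) :
  (forall S, stage S -> C S -> C (elim S)) ->
  (forall F, F `<=` stage -> F `<=` C -> C (meet F)) ->
  forall S, stage S -> C S.
Proof.
move=> CE CM S sS; suff [] : stage S /\ C S by [].
apply: (sS [set S | stage S /\ C S]) => [S' [sS' CS']|F FC].
  by split; [exact: stage_eliminate|exact: CE].
split; first by apply: stage_meet => S' /FC[].
by apply: CM => S' /FC[].
Qed.

(** The comparison argument of the Bourbaki-Witt theorem, with inclusion reversed: an extreme stage
    is comparable with all stages, and this comparability carries the induction showing that every
    stage is extreme. *)
Lemma stage_cases S S' : stage S -> stage S' -> S `<<=` S' \/ S' `<<=` elim S.
Proof.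
move=> sS; move: S sS S'.
pose extreme S := forall S', stage S' -> S `<<=` S' -> ~ S' `<<=` S ->
  S `<<=` elim S'.
have ext_cases S : stage S -> extreme S ->
    forall S', stage S' -> S `<<=` S' \/ S' `<<=` elim S.
  move=> sS eS; apply: stage_ind => [S' sS' [SS'|S'S]|F sF FC].
  - have [S'S|S'S] := pselect (S' `<<=` S).
      by right; rewrite (strategies_ext SS' S'S) => i s.
    by left; exact: eS.
  - right; move=> i s /eliminate_sub; exact: S'S.
  - have [FS|] := pselect (exists2 S', F S' & S' `<<=` elim S).
      have [S' FS' S'S] := FS; right=> i s /(_ _ FS'); exact: S'S.
    move=> nF; left; apply: sub_meet => S' FS'.
    case: (FC _ FS') => h; first exact: h.
    by exfalso; apply: nF; exists S'; [exact: FS'|exact: h].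
suff ext S : stage S -> extreme S.
  by move=> S sS; exact: (ext_cases _ sS (ext _ sS)).
move: S; apply: stage_ind => [S sS eS S' sS' SS' S'S|F sF FC S' sS' FS' S'F].
  have [h|//] := ext_cases _ sS eS _ sS'.
  exact: eliminate_mono.
have [S FS nS] : exists2 S, F S & ~ S' `<<=` S.
  apply: contrapT => H; apply: S'F; apply: sub_meet => S FS.
  by apply: contrapT => nS; apply: H; exists S.
have [SS'|h] := ext_cases _ (sF _ FS) (FC _ FS) _ sS'; last first.
  by exfalso; apply: nS => i s /h; exact: eliminate_sub.
move=> i s /(_ _ FS); exact: (FC _ FS _ sS' SS' nS).
Qed.

Definition stages : Type := {S : strategies | stage S}.
HB.instance Definition _ := gen_eqMixin stages.
HB.instance Definition _ := gen_choiceMixin stages.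

Definition le_stages (a b : stages) : bool := `[< sval b `<<=` sval a >].
Lemma stages_ext (a b : stages) :
  sval a `<<=` sval b -> sval b `<<=` sval a -> a = b.
Proof.
case: a b => [S sS] [S' sS'] /= h h'; move: sS'.
by rewrite -(strategies_ext h h') => sS'; rewrite (Prop_irrelevance sS sS').
Qed.

Fact le_stages_refl : reflexive le_stages.
Proof. by move=> a; apply/asboolP => i s. Qed.

Fact le_stages_anti : antisymmetric le_stages.
Proof. by move=> a b /andP[/asboolP ab /asboolP ba]; exact: stages_ext. Qed.

Fact le_stages_trans : transitive le_stages.
Proof.
move=> b a c /asboolP ba /asboolP cb; apply/asboolP => i s /cb; exact: ba.
Qed.

Fact le_stages_total : total le_stages.
Proof.
move=> a b; apply/orP.
have [h|h] := stage_cases (svalP a) (svalP b); [right|left]; apply/asboolP => //.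
by move=> i s /h; exact: eliminate_sub.
Qed.

Fact stages_display : Order.disp_t. Proof. exact: Order.Disp tt tt. Qed.

HB.instance Definition _ := Order.isPOrder.Build stages_display stages
  (fun _ _ => erefl) le_stages_refl le_stages_anti le_stages_trans.
HB.instance Definition _ :=
  Order.POrder_isTotal.Build stages_display stages le_stages_total.

Lemma le_stagesP (a b : stages) : reflect (sval b `<<=` sval a) (a <= b)%O.
Proof. exact: asboolP. Qed.

Lemma lt_stagesP (a b : stages) : (a < b)%O <-> ~ sval a `<<=` sval b.
Proof.
rewrite ltNge; split=> [/negP h ab|ab]; first by apply/h/le_stagesP.
by apply/negP => /le_stagesP.
Qed.

Lemma stage_lower S S' : elim S = S -> stage S' -> S `<<=` S'.
Proof.
move=> eS; move: S'; apply: stage_ind => [S' _ SS'|F _ FC].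
  by rewrite -eS; exact: eliminate_mono.
by apply: sub_meet => S' /FC.
Qed.

Definition next_stage (a : stages) : stages :=
  exist _ _ (stage_eliminate (svalP a)).

Lemma meet_stage_proof (F : set stages) : stage (meet (sval @` F)).
Proof. by apply: stage_meet => _ [a _ <-]; exact: svalP. Qed.

Definition meet_stage (F : set stages) : stages := exist _ _ (meet_stage_proof F).

(** Let a be the meet of all lower bounds of F, itself a lower bound. If a is not in F, its
    elimination is a lower bound too, which forces a to be fixed by elimination. A fixed family lies
    inside every stage, so a is the last stage and the given member of F equals it. *)
Lemma stages_min (F : set stages) : F !=set0 ->
  exists2 a, F a & forall b, F b -> (a <= b)%O.
Proof.
move=> [a0 Fa0].
pose a := meet_stage [set c : stages | forall b, F b -> (c <= b)%O].
have ab b : F b -> (a <= b)%O.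
  by move=> Fb; apply/le_stagesP; apply: sub_meet => _ [c cF <-]; exact/le_stagesP/(cF _ Fb).
have [Fa|Fa] := pselect (F a); first by exists a.
have nab b : F b -> (next_stage a <= b)%O.
  move=> Fb; apply/le_stagesP.
  have [h|//] := stage_cases (svalP a) (svalP b).
  by case: Fa; rewrite (stages_ext h (elimT (le_stagesP _ _) (ab _ Fb))).
have ea : elim (sval a) = sval a.
  apply: strategies_ext; first exact: eliminate_sub.
  by apply: meet_sub; exists (next_stage a).
exists a0 => // b Fb; apply/le_stagesP.
have -> : a0 = a; last exact/le_stagesP/ab.
apply: stages_ext; first exact/le_stagesP/ab.
exact: stage_lower ea (svalP a0).
Qed.

Lemma stages_wf : well_founded (fun b c : stages => (b < c)%O).
Proof.
move=> a; apply: contrapT => na.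
have [b nb bmin] := @stages_min [set b | ~ Acc (fun b c : stages => (b < c)%O) b]
  (ex_intro _ a na).
apply: nb; constructor => c cb; apply: contrapT => nc.
by move: cb; rewrite ltNge => /negP; apply; exact: bmin.
Qed.

Lemma stages_elimination : elimination_stages pi (fun a : stages => sval a).
Proof.
split.
- move=> a a0 i; apply/seteqP; split=> // s _.
  have := a0 (meet_stage set0); move/le_stagesP; apply.
  by move=> S [b []].
- move=> a b [/lt_stagesP ab bmin] i; congr (_ i).
  have [h|ba] := stage_cases (svalP a) (svalP b); first by case: ab.
  apply: strategies_ext => //; apply/(le_stagesP b (next_stage a))/bmin.
  apply/lt_stagesP => h; apply: ab.
  apply: stage_lower (svalP b); apply: strategies_ext => //.
  exact: eliminate_sub.
- move=> a [a0 asucc] i.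
  (* If this meet were earlier than a, it would be the last stage before a, making a its successor
     rather than a limit. *)
  pose c := meet_stage [set b | (b < a)%O].
  have ac : sval a `<<=` sval c.
    by apply: sub_meet => _ [b /ltW/le_stagesP ba <-].
  have ca : c = a.
    apply: contrapT => ca.
    have ca' : (c < a)%O by apply/lt_stagesP => h; apply: ca; exact: stages_ext.
    have [h|anc] := stage_cases (svalP c) (svalP a).
      by move/lt_stagesP : ca'.
    apply: (asucc c); split=> // b /lt_stagesP cb; rewrite leNgt; apply/negP => ba.
    by apply: cb => i' s h; apply: h; exists b.
  apply/seteqP; split=> [s sa b /ltW/le_stagesP ba|s sb]; first exact: ba.
  by rewrite -ca => S [b ba <-]; exact: sb.
Qed.

Lemma RATP i s : RAT pi i s <-> exists S, S `<<=` elim S /\ S i s.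
Proof.
split=> [[d [W [Y [a [_ _ sY _ Yas]]]]]|[S [SS Sis]]].
  exists (Y a); split=> // j t Yt.
  by rewrite (sY j).
have Sle S' : stage S' -> S `<<=` S'.
  move: S'; apply: stage_ind => [S' _ SS' j t /SS|F _ FC].
    exact: (eliminate_mono SS').
  by apply: sub_meet => S' /FC.
(* The meet of all stages is the smallest stage, hence fixed by elimination; an earlier stable stage
   would lie inside it, which contradicts being strictly earlier. *)
pose a := meet_stage setT.
have amin S' : stage S' -> sval a `<<=` S'.
  by move=> sS'; apply: meet_sub; exists (exist _ S' sS').
have ea : elim (sval a) = sval a.
  apply: strategies_ext; first exact: eliminate_sub.
  by apply: amin; apply: stage_eliminate; exact: svalP.
exists stages_display, stages, (fun a => sval a), a; split.
- exact: stages_wf.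
- exact: stages_elimination.
- by move=> j; exact: (congr1 (fun S : strategies => S j) ea).
- move=> b /lt_stagesP ba sb; apply: ba; apply: stage_lower (svalP a).
  by apply: functional_extensionality_dep => j; exact: sb.
- exact: Sle (svalP a) i s Sis.
Qed.

End elimination.

(** * From an epistemic model to both solution concepts *)

Lemma full_measure_map (R : realType) (X Y : topologicalType) (f : X -> Y)
    (cf : continuous f) (mu : Delta R X) (K : nat -> set X) (S : set Y) :
  hausdorff_space Y -> (forall n, compact (K n)) ->
  full_measure mu (\bigcup_n K n) -> (forall x, S (f x)) ->
  full_measure (Delta_map cf mu) S.
Proof.
move=> hY cK /full_measureP[A [mA AK muA]] Sf; apply/full_measureP.
pose B := \bigcup_n f @` K n.
have mB (h : [set: Y] !=set0) : measurable (B : set (borel h)).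
  apply: bigcupT_measurable => n; apply: closed_borel.
  apply: compact_closed => //; apply: continuous_compact => //.
  exact: continuous_subspaceT.
exists B; split=> //; first by move=> _ [n _ [x _ <-]].
have mfB := @Delta_preimage _ _ f cf (Delta_nonempty mu) _ _
  (mB (Delta_nonempty (Delta_map cf mu))).
have AfB : A `<=` f @^-1` B by move=> x /AK[n _ Kx]; exists n => //; exists x.
have mB' := mB (Delta_nonempty (Delta_map cf mu)).
exact: etrans (Delta_mapE cf mu mB') (probability_eq1 mA mfB AfB muA).
Qed.

Lemma continuous_pair (Y Z W : topologicalType) (f : Y -> Z) (g : Y -> W) :
  continuous f -> continuous g -> continuous (fun y => (f y, g y)).
Proof. by move=> cf cg y; exact: (cvg_pair (cf y) (cg y)). Qed.

Section epistemic_model.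
Context (R : realType) (X : bool -> topologicalType).
Variable pi : bool -> X false * X true -> R.
Hypothesis pX : forall i, polish R (X i).
Context (Theta : bool -> topologicalType) (sigma : forall i, Theta i -> X i).
Arguments sigma {i} _.
Variable beta : forall i, Theta i -> Delta R (Theta (~~ i)).
Arguments beta {i} _.
Hypothesis csigma : forall i, continuous (@sigma i).
Hypothesis cbeta : forall i, continuous (@beta i).
Hypothesis tight_beta : forall i (t : Theta i),
  exists K : nat -> set (Theta (~~ i)), (forall n, compact (K n)) /\
    full_measure (beta t) (\bigcup_n K n).
Hypothesis br_beta : forall i (t : Theta i),
  best_response pi (sigma t) (Delta_map (@csigma (~~ i)) (beta t)).

Lemma full_measure_beta i (t : Theta i) (Y : topologicalType)
    (f : Theta (~~ i) -> Y) (cf : continuous f) (S : set Y) :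
  hausdorff_space Y -> (forall x, S (f x)) ->
  full_measure (Delta_map cf (beta t)) S.
Proof.
move=> hY Sf; have [K [cK fK]] := tight_beta t.
exact: full_measure_map hY cK fK Sf.
Qed.

Lemma model_RAT i (t : Theta i) : RAT pi i (sigma t).
Proof.
apply/RATP; exists (fun i => range (@sigma i)); split; last by exists t.
move=> j _ [u _ <-]; split; first by exists u.
exists (Delta_map (@csigma (~~ j)) (beta u)); last exact: br_beta.
by apply: full_measure_beta; [exact: (@hausdorff_polish R)|move=> x; exists x].
Qed.

Lemma continuous_Delta_map_beta i (Y : topologicalType) (f : Theta (~~ i) -> Y)
  (cf : continuous f) : continuous (fun t : Theta i => Delta_map cf (beta t)).
Proof.
move=> t; apply: (continuous_comp (@cbeta i t)).
exact: Delta_map_continuous.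
Qed.

(** Maps and continuity proofs are built together, since the next level takes images of beliefs
    under these maps and [Delta_map] requires continuity. *)
Fixpoint level_map n : forall i, {f : Theta (~~ i) -> level R X n i | continuous f} :=
  match n with
  | 0 => fun i =>
      exist (fun f : Theta (~~ i) -> level R X 0 i => continuous f)
        (@sigma (~~ i)) (@csigma (~~ i))
  | n'.+1 => fun i =>
      exist (fun f : Theta (~~ i) -> level R X n'.+1 i => continuous f)
      (fun t : Theta (~~ i) => (sval (level_map n' i) t,
         Delta_map (svalP (level_map n' (~~ i))) (beta t)))
      (continuous_pair (svalP (level_map n' i))
         (@continuous_Delta_map_beta (~~ i) _ _ (svalP (level_map n' (~~ i)))))
  end.

Definition hierarchy_of i (t : Theta i) : hierarchy R X i :=
  fun n => Delta_map (svalP (level_map n i)) (beta t).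

Lemma continuous_hierarchy_of i : continuous (@hierarchy_of i).
Proof.
move=> t; have FF : Filter (@hierarchy_of i @ t) by exact: fmap_filter.
apply/prod_topology_cvgP => n.
exact: (@continuous_Delta_map_beta i _ _ (svalP (level_map n i)) t).
Qed.

Lemma coherent_hierarchy_of i (t : Theta i) : coherent (hierarchy_of t).
Proof. by move=> n; exact: Delta_map_comp. Qed.

Let lift i (t : Theta i) : X i * hierarchy R X i := (sigma t, hierarchy_of t).

Let clift i : continuous (@lift i) :=
  continuous_pair (@csigma i) (@continuous_hierarchy_of i).

Lemma level_proj_lift n i (t : Theta (~~ i)) :
  level_proj n (lift t) = sval (level_map n i) t.
Proof. by elim: n => //= n ->. Qed.

Lemma extends_hierarchy_of i (t : Theta i) :
  extends (hierarchy_of t) (Delta_map (@clift (~~ i)) (beta t)).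
Proof. by move=> n; apply: Delta_map_comp => u; exact: level_proj_lift. Qed.

Lemma type_approx_hierarchy_of k i (t : Theta i) :
  type_approx (R := R) (X := X) k (hierarchy_of t).
Proof.
elim: k i t => [|k IH] i t; first exact: coherent_hierarchy_of.
split; first exact: coherent_hierarchy_of.
exists (Delta_map (@clift (~~ i)) (beta t)); split.
  exact: extends_hierarchy_of.
apply: full_measure_beta => [|u /=]; last exact: IH.
by apply: hausdorff_pair; [exact: (@hausdorff_polish R)|exact: hausdorff_hierarchy].
Qed.

Lemma types_hierarchy_of i (t : Theta i) :
  (\bigcap_k @type_approx R X k i) (hierarchy_of t).
Proof. by move=> k _; exact: type_approx_hierarchy_of. Qed.

Definition type_of i (t : Theta i) : types R X i :=
  exist _ (hierarchy_of t) (mem_set (types_hierarchy_of t)).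

Lemma continuous_type_of i : continuous (@type_of i).
Proof.
move=> t; have FF : Filter (@type_of i @ t) by exact: fmap_filter.
by apply: initial_topology_cvg; exact: continuous_hierarchy_of.
Qed.

Let tlift i (t : Theta i) : X i * types R X i := (sigma t, type_of t).

Let ctlift i : continuous (@tlift i) :=
  continuous_pair (@csigma i) (@continuous_type_of i).

Lemma belief_type_of i (t : Theta i) :
  belief (type_of t) (Delta_map (@ctlift (~~ i)) (beta t)).
Proof.
rewrite /belief (Delta_map_comp _ _ (@clift (~~ i)))//.
exact: extends_hierarchy_of.
Qed.

Lemma rational_type_of n i (t : Theta i) :
  rational_belief pi n (sigma t, type_of t).
Proof.
elim: n i t => [|n IH] i t /=.
  exists (Delta_map (@ctlift (~~ i)) (beta t)); split; first exact: belief_type_of.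
  by rewrite /marg_fst (Delta_map_comp _ _ (@csigma (~~ i)))//; exact: br_beta.
split; first exact: IH.
exists (Delta_map (@ctlift (~~ i)) (beta t)); split; first exact: belief_type_of.
apply: full_measure_beta => [|u]; last exact: IH.
by apply: hausdorff_pair; [exact: (@hausdorff_polish R)|exact: hausdorff_types].
Qed.

Lemma model_RCBR i (t : Theta i) : RCBR pi i (sigma t).
Proof. by exists (type_of t) => n; exact: rational_type_of. Qed.

End epistemic_model.

(* The outer measure of S is 1; unlike [full_measure], S need not be measurable
   for the completion. *)
Definition outer_full (R : realType) (X : topologicalType) (mu : Delta R X)
    (S : set X) : Prop :=
  forall A : set (borel (Delta_nonempty mu)), measurable A -> S `<=` A ->
    mu A = 1%E.

Lemma full_outer_full (R : realType) (X : topologicalType) (mu : Delta R X)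
  (S : set X) : full_measure mu S -> outer_full mu S.
Proof.
move=> /full_measureP[A [mA AS muA]] B mB SB.
exact: (probability_eq1 mA mB (subset_trans AS SB) muA).
Qed.

(** * Uniqueness of beliefs and the family of strategies consistent with RCBR *)

Section belief_unique.
Context (R : realType) (X : bool -> topologicalType).
Hypothesis pX : forall i, polish R (X i).
Variable i : bool.

Let Y : topologicalType := (X (~~ i) * types R X (~~ i))%type.

Let lp n (p : Y) : level R X n i := level_proj n (types_incl p).

Let clp n : continuous (@lp n).
Proof.
move=> p; apply: (continuous_comp (@continuous_types_incl R X (~~ i) p)).
exact: continuous_level_proj.
Qed.

Definition cylinders : set (set Y) :=
  [set A | exists n (V : set (level R X n i)), open V /\ A = @lp n @^-1` V].

Let lift_cylinder n m (V : set (level R X n i)) : open V ->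
  exists V' : set (level R X (m + n) i),
    open V' /\ @lp n @^-1` V = @lp (m + n) @^-1` V'.
Proof.
move=> oV; elim: m => [|m [V' [oV' ->]]]; first by exists V.
exists (fst @^-1` V'); split=> //.
have /continuousP := @continuous_fst (level R X (m + n) i)
  (Delta R (level R X (m + n) (~~ i))).
exact.
Qed.

Let cylinders_open : cylinders `<=` open.
Proof. by move=> A [n [V [oV ->]]]; have /continuousP := @clp n; exact. Qed.

Let cylinders_setI : setI_closed cylinders.
Proof.
move=> A B [n [V [oV ->]]] [m [W [oW ->]]].
have [V' [oV' ->]] := lift_cylinder m oV.
have [W' [oW' ->]] := lift_cylinder n oW.
move: W' oW'; rewrite addnC => W' oW'; exists (m + n)%N, (V' `&` W').
by split; [exact: openI|rewrite preimage_setI].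
Qed.

Let cylinder_nbhs (y : Y) : set_system Y :=
  [set U | exists2 A, cylinders A & A y /\ A `<=` U].

Let cylinder_nbhs_filter y : Filter (cylinder_nbhs y).
Proof.
split.
- exists setT => //; exists 0%N, setT.
  by split; [exact: openT|rewrite preimage_setT].
- move=> U V [A cA [Ay AU]] [B cB [By BV]]; exists (A `&` B).
    exact: cylinders_setI.
  by split=> // z [Az Bz]; split; [exact: AU|exact: BV].
- move=> U V UV [A cA [Ay AU]]; exists A => //; split=> //.
  exact: subset_trans UV.
Qed.

Let cylinder_nbhs_lp n y : @lp n @ cylinder_nbhs y --> lp n y.
Proof.
move=> V; rewrite nbhsE => -[W [oW Wy] WV].
by exists (@lp n @^-1` W); [exists n, W|split=> // z /WV].
Qed.

(** Types carry the initial topology of their coordinates, so convergence under every [lp n] implies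
    convergence; hence the cylinders form a base. *)
Let cylinder_nbhs_cvg y : cylinder_nbhs y --> y.
Proof.
have FF := cylinder_nbhs_filter y.
have c1 : fst @ cylinder_nbhs y --> y.1 := @cylinder_nbhs_lp 0%N y.
have c2 : snd @ cylinder_nbhs y --> y.2.
  apply: initial_topology_cvg; apply/prod_topology_cvgP => n.
  have := @cylinder_nbhs_lp n.+1 y.
  move=> h; have /= := cvg_comp _ _ h (@continuous_snd _ _ (lp n.+1 y)).
  exact.
move=> U [[A B] /= [yA yB] ABU].
have h1 : cylinder_nbhs y (fst @^-1` A) := c1 _ yA.
have h2 : cylinder_nbhs y (snd @^-1` B) := c2 _ yB.
by apply: filterS2 h1 h2 => z zA zB; exact: ABU.
Qed.

Let cylinders_base (U : set Y) : open U -> exists2 F : nat -> set Y,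
  (forall n, cylinders (F n) \/ F n = set0) & U = \bigcup_n F n.
Proof.
move=> oU.
have HV n : exists V : nat -> set (level R X n i),
    (forall k, open (V k)) /\ forall U y, open U -> U y ->
      exists k, V k y /\ V k `<=` U.
  exact: (bumpable_base (bumpable_level pX n i)).
pose V n := sval (cid (HV n)).
have VP n : (forall k, open (V n k)) /\ forall U y, open U -> U y ->
    exists k, V n k y /\ V n k `<=` U := svalP (cid (HV n)).
pose c n : nat * nat := odflt (0%N, 0%N) (unpickle n).
pose A n := @lp (c n).1 @^-1` (V (c n).1 (c n).2).
exists (fun n => if pselect (A n `<=` U) then A n else set0).
  move=> n /=; case: (pselect (A n `<=` U)) => h /=; [left|by right].
  exists (c n).1, (V (c n).1 (c n).2); split=> //; exact: (VP _).1.
apply/seteqP; split=> [y Uy|y [n _]]; last first.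
  by case: (pselect (A n `<=` U)) => //= h /h.
have [A' [n [W [oW WA]]] [Wy WU]] : cylinder_nbhs y U.
  by apply: cylinder_nbhs_cvg; exact: open_nbhs_nbhs.
subst A'.
have [k [Vk kW]] := (VP n).2 W (lp n y) oW Wy.
exists (pickle (n, k)) => //; case: (pselect (A _ `<=` U)) => [h|[]] /=; rewrite /A /c pickleK//=.
by move=> z /kW /WU.
Qed.

(** The uniqueness half of Kolmogorov extension. Each stage of [rational_belief] comes with its own
    witness nu, and these must be merged into one. *)
Lemma belief_unique (t : types R X i) (nu nu' : Delta R Y) :
  belief t nu -> belief t nu' -> nu = nu'.
Proof.
move=> b b'; apply: (Delta_eq_base cylinders_open cylinders_setI cylinders_base).
move=> _ [n [V [oV ->]]].
have E (ka : Delta R Y) : belief t ka -> Delta_map (@clp n) ka = set_val t n.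
  by move=> <-; rewrite (Delta_map_comp _ _ (@clp n)).
have oV' h : measurable (V : set (borel h)) by exact: open_borel.
have mE (ka : Delta R Y) :=
  Delta_mapE (@clp n) ka (oV' (Delta_nonempty (Delta_map (@clp n) ka))).
by rewrite -(mE nu) -(mE nu') (E nu b) (E nu' b').
Qed.

End belief_unique.

(** The belief of a supporting type gives measure one to the intersection of Borel sets inside all
    [rational_belief n]. This intersection projects into [RCBR], but its projection need not be
    Borel, so the conclusion is about Borel supersets of [RCBR]. *)
Lemma RCBR_outer_full (R : realType) (X : bool -> topologicalType)
    (pX : forall i, polish R (X i)) (pi : bool -> X false * X true -> R) i s :
  RCBR pi i s -> exists mu : Delta R (X (~~ i)),
    outer_full mu (RCBR pi (~~ i)) /\ best_response pi s mu.
Proof.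
move=> [t st]; have [nu [bnu brnu]] := st 0%N.
exists (marg_fst nu); split=> // A mA RA.
have HB n : exists B : set (borel (Delta_nonempty nu)),
    [/\ measurable B, B `<=` @rational_belief R X pi n (~~ i) & nu B = 1%E].
  have [_ [nu' [bnu' fnu']]] := st n.+1.
  by apply/full_measureP; rewrite (belief_unique pX bnu bnu').
have [B BP] := choice HB.
have mfA := @Delta_preimage _ _ _ (@continuous_fst _ _) (Delta_nonempty nu) _ _ mA.
have nuB : nu (\bigcap_n B n) = 1%E.
  by apply: probability_bigcap1 => n; have [] := BP n.
rewrite /marg_fst.
have mB : measurable (\bigcap_n B n).
  by apply: bigcapT_measurable => n; have [] := BP n.
apply: etrans (Delta_mapE _ _ mA) (probability_eq1 mB mfA _ nuB).
move=> [x t'] /= xB; apply: RA; exists t' => n.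
by have [_ + _] := BP n; apply; exact: xB.
Qed.

(* [pre w m] lists w 0, ..., w m.-1 in reverse order, so that the children of the
   node u of the tree of finite sequences are the a :: u. *)
Fixpoint pre (w : nat -> nat) (m : nat) : seq nat :=
  if m is m'.+1 then w m' :: pre w m' else [::].

Lemma size_pre w m : size (pre w m) = m.
Proof. by elim: m => //= m ->. Qed.

Lemma pre_eqP w w' m : pre w m = pre w' m <-> forall k, (k < m)%N -> w k = w' k.
Proof.
elim: m => [|m IH] /=; first by split.
split=> [[wm /IH h] k|h].
  by rewrite ltnS leq_eqVlt => /orP[/eqP->|/h].
congr (_ :: _); first exact: h.
by apply/IH => k km; apply: h; exact: ltnW.
Qed.

Lemma pre_le w w' m n : (m <= n)%N -> pre w n = pre w' n -> pre w m = pre w' m.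
Proof.
move=> mn /pre_eqP h; apply/pre_eqP => k km; apply: h; exact: leq_trans mn.
Qed.

(** * Closed subspaces of Baire space *)

Definition branches (D : set (nat -> nat)) : Type := {w | D w}.

Section branches.
Variable D : set (nat -> nat).
Local Notation B := (branches D).

HB.instance Definition _ := gen_eqMixin B.
HB.instance Definition _ := gen_choiceMixin B.

Definition node (u : seq nat) : set B := [set t | pre (sval t) (size u) = u].

Definition branches_nbhs (t : B) : set_system B :=
  [set U | exists m, node (pre (sval t) m) `<=` U].

HB.instance Definition _ := hasNbhs.Build B branches_nbhs.

Lemma node_pre (t : B) m : node (pre (sval t) m) t.
Proof. by rewrite /node/= size_pre. Qed.

Let branches_filter (t : B) : ProperFilter (nbhs t).
Proof.
split; first by move=> [m /(_ t (node_pre t m))].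
split.
- by exists 0%N.
- move=> U V [m mU] [n nV]; exists (maxn m n) => s.
  rewrite /node/= size_pre => E; split; [apply: mU|apply: nV];
    rewrite /node/= size_pre; apply: pre_le E; [exact: leq_maxl|exact: leq_maxr].
- by move=> U V UV [m mU]; exists m; exact: subset_trans UV.
Qed.

Let branches_singleton (t : B) (U : set B) : nbhs t U -> U t.
Proof. by move=> [m]; apply; exact: node_pre. Qed.

Let branches_nbhs_nbhs (t : B) (U : set B) : nbhs t U -> nbhs t (nbhs^~ U).
Proof.
move=> [m mU]; exists m => s; rewrite /node/= size_pre => E.
by exists m; rewrite E.
Qed.

HB.instance Definition _ := Nbhs_isNbhsTopological.Build B
  branches_filter branches_singleton branches_nbhs_nbhs.

Lemma nbhs_node (t : B) m : nbhs t (node (pre (sval t) m)).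
Proof. by exists m. Qed.

Lemma nbhs_branchesP (t : B) (U : set B) : nbhs t U ->
  exists m, node (pre (sval t) m) `<=` U.
Proof. by []. Qed.

Lemma open_node u : open (node u).
Proof.
rewrite openE => t; rewrite /node/= => tu; rewrite /interior.
by exists (size u); rewrite tu.
Qed.

Lemma node_disjoint u v t : node u t -> node v t -> (size u <= size v)%N ->
  node v `<=` node u.
Proof.
rewrite /node/= => tu tv uv s /= sv; rewrite -[RHS]tu.
by apply: pre_le uv _; rewrite sv tv.
Qed.

(** Two nodes are nested or disjoint; the empty set is included to close the family under
    intersection. *)
Definition nodes : set (set B) := [set A | A = set0 \/ exists u, A = node u].

Lemma nodes_open : nodes `<=` open.
Proof. by move=> A [->|[u ->]]; [exact: open0|exact: open_node]. Qed.

Lemma nodes_setI : setI_closed nodes.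
Proof.
move=> A A' [->|[u ->]]; first by rewrite set0I; left.
move=> [->|[v ->]]; first by rewrite setI0; left.
have [[t [tu tv]]|uv] := pselect (node u `&` node v !=set0); last first.
  by left; apply/eqP; apply: contra_notT uv => /set0P.
right; have [h|h] := leP (size u) (size v).
  by exists v; apply/setIidPr/(node_disjoint tu tv h).
by exists u; apply/setIidPl/(node_disjoint tv tu (ltnW h)).
Qed.

Lemma open_nodesE (U : set B) : open U ->
  U = \bigcup_n (let u := odflt [::] (unpickle n) in
    if pselect (node u `<=` U) then node u else set0).
Proof.
move=> oU; apply/seteqP; split=> [t Ut|t [n _ /=]]; last first.
  by case: (pselect (node _ `<=` U)) => //= h /h.
have [m mU] : nbhs t U by exact: open_nbhs_nbhs.
exists (pickle (pre (sval t) m)) => //; rewrite pickleK/=.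
by case: (pselect (node _ `<=` U)) => //= _; exact: node_pre.
Qed.

Lemma nodes_base (U : set B) : open U -> exists2 F : nat -> set B,
  (forall n, nodes (F n) \/ F n = set0) & U = \bigcup_n F n.
Proof.
move=> /open_nodesE UE; eexists; last exact: UE.
move=> n /=; case: (pselect (node _ `<=` U)) => _ /=; last by right.
by left; right; exists (odflt [::] (unpickle n)).
Qed.

Lemma measurable_branches d (T : measurableType d) (f : T -> B) :
  (forall u, measurable (f @^-1` node u)) ->
  forall U, open U -> measurable (f @^-1` U).
Proof.
move=> mf U /open_nodesE ->; rewrite preimage_bigcup.
apply: bigcupT_measurable => n /=.
case: (pselect (node _ `<=` U)) => _ /=; first exact: mf.
by rewrite preimage_set0.
Qed.

Hypothesis Dclosed :
  forall w, (forall m, exists2 w', D w' & pre w' m = pre w m) -> D w.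

(** An ultrafilter settles each coordinate on one of its finitely many values, and closedness of D
    keeps the resulting sequence in the space. *)
Lemma branches_compact (b : nat -> nat) :
  compact [set t : B | forall n, (sval t n <= b n)%N].
Proof.
rewrite compact_ultra => F FU Fb.
have [a aF] : {a : nat -> nat & forall n, F [set t : B | sval t n = a n]}.
  apply: (@choice _ _ (fun n a => F [set t : B | sval t n = a])) => n.
  have : F [set t : B | (sval t n <= b n)%N] by apply: filterS Fb => t; exact.
  elim: (b n) => [|c IH] Fc.
    by exists 0%N; apply: filterS Fc => t /=; rewrite leqn0 => /eqP.
  have [h|h] := in_ultra_setVsetC [set t : B | sval t n = c.+1] FU.
    by exists c.+1.
  apply: IH; apply: filterS2 Fc h => t /= + /eqP h.
  by rewrite leq_eqVlt (negbTE h).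
have FN m : F [set t : B | pre (sval t) m = pre a m].
  elim: m => [|m IH]; first exact: filterS filterT.
  by apply: filterS2 IH (aF m) => t /= -> ->.
have Da : D a.
  apply: Dclosed => m; have [t tm] := @filter_ex _ F _ _ (FN m).
  by exists (sval t); [exact: svalP|].
exists (exist _ a Da); split.
  move=> n /=; have [t [<- tb]] := @filter_ex _ F _ _ (filterI (aF n) Fb).
  exact: tb.
move=> U [m mU]; apply: filterS (FN m) => t tm; apply: mU.
by rewrite /node/= size_pre.
Qed.

Lemma branches_tight (R : realType) (mu : Delta R B) : exists K : nat -> set B,
  (forall n, compact (K n)) /\ full_measure mu (\bigcup_n K n).
Proof.
have oA n c : open [set t : B | (c < sval t n)%N].
  rewrite openE => t /= ct; exists n.+1 => s.
  by rewrite /node/= size_pre => -[-> _].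
have oC n c : open [set t : B | (sval t n <= c)%N].
  rewrite openE => t /= ct; exists n.+1 => s.
  by rewrite /node/= size_pre => -[-> _].
have [b mub] := @probability_tight _ _ _ mu (fun n t => sval t n)
  (fun n c => open_borel (oA n c)).
exists (fun k => [set t : B | forall n, (sval t n <= b k n)%N]); split.
  by move=> k; exact: branches_compact.
apply/full_measureP; eexists; split; [|exact: subset_refl|exact: mub].
apply: bigcupT_measurable => k.
rewrite (_ : mkset _ = \bigcap_n [set t : B | (sval t n <= b k n)%N]).
  by apply: bigcapT_measurable => n; exact: open_borel.
by apply/seteqP; split=> t /= h n => [_|]; exact: h.
Qed.

End branches.

(** * The unit interval and quantile maps of tree weights *)

Section unit_interval.
Context (R : realType).
Local Notation I01 := (`[0%R, 1%R[%classic : set (measurableTypeR R)).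

Definition unit_measure : set (measurableTypeR R) -> \bar R :=
  mrestr lebesgue_measure (measurable_itv `[0%R, 1%R[ : measurable I01).

HB.instance Definition _ := Measure.on unit_measure.

Let unit_measureT : unit_measure setT = 1%E.
Proof.
rewrite /unit_measure /mrestr setTI lebesgue_measure_itv/= lte_fin ltr01.
by rewrite oppr0 adde0.
Qed.

HB.instance Definition _ :=
  Measure_isProbability.Build _ _ _ unit_measure unit_measureT.

Lemma unit_measure_itv (a b : R) : 0 <= a -> a <= b -> b <= 1 ->
  unit_measure `[a, b[%classic = (b - a)%:E.
Proof.
move=> a0 ab b1; rewrite /unit_measure /mrestr setIidl.
  rewrite lebesgue_measure_itv/= lte_fin; case: ltP => //= ba.
  by have -> : b - a = 0 by lra.
by move=> x /=; rewrite !in_itv/=; lra.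
Qed.

Lemma eq_unit_measure (A B : set (measurableTypeR R)) :
  A `&` I01 = B `&` I01 -> unit_measure A = unit_measure B.
Proof. by rewrite /unit_measure /mrestr => ->. Qed.

Lemma unit_measure_ae (A : set (measurableTypeR R)) :
  (forall x, 0 <= x < 1 -> A x) -> {ae unit_measure, forall x, A x}.
Proof.
move=> h; exists (~` I01); split.
- by apply: measurableC; exact: measurable_itv.
- by rewrite /unit_measure /mrestr setICl measure0.
- by move=> x /= nA; apply: contra_not nA; rewrite in_itv/=; exact: h.
Qed.

Lemma unit_measure_ae_neq (s : nat -> R) :
  {ae unit_measure, forall x, forall n, x <> s n}.
Proof.
have [A [mA A0 sA]] : unit_measure.-negligible (\bigcup_n [set s n]).
  apply: negligible_bigcup => n; exists [set s n]; split=> //.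
  apply/eqP; rewrite eq_le measure_ge0 andbT -(lebesgue_measure_set1 (s n)).
  apply: le_measure; rewrite ?inE//.
  by apply: measurableI => //; exact: measurable_itv.
exists A; split=> // x /= nx; apply: sA; apply: contrapT => h; apply: nx => n xn.
by apply: h; exists n.
Qed.

End unit_interval.

Section quantile.
Context (R : realType).
Implicit Type c : seq nat -> R.

(** The last two clauses say that the weights of the children of u sum to c u. In terms of finite
    sums they can be checked in a limit of weights, once the n of the last clause is shared by the
    approximating weights. *)
Definition tree_weights c : Prop :=
  [/\ c [::] = 1, forall u, 0 <= c u,
      forall u n, \sum_(a < n) c (val a :: u) <= c u
    & forall u e, 0 < e -> exists n, c u - e <= \sum_(a < n) c (val a :: u)].

(* The node u carries the interval [left_end u, left_end u + c u[, and its children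
   cut this interval in consecutive pieces. *)
Fixpoint left_end c (u : seq nat) : R :=
  if u is a :: v then left_end c v + \sum_(b < a) c (val b :: v) else 0.

(** For tree weights and x in [0, 1[ some child interval always contains x, so the default digit 0
    is never taken. *)
Fixpoint interval_node c (x : R) (m : nat) : seq nat :=
  if m is m'.+1 then
    let u := interval_node c x m' in
    xget 0%N [set a | left_end c (a :: u) <= x < left_end c (a.+1 :: u)] :: u
  else [::].

Definition quantile c (x : R) (n : nat) : nat := head 0%N (interval_node c x n.+1).

Lemma pre_quantile c x m : pre (quantile c x) m = interval_node c x m.
Proof. by elim: m => //= m ->. Qed.

Lemma left_endS c a u :
  left_end c (a.+1 :: u) = left_end c (a :: u) + c (a :: u).
Proof. by rewrite /= big_ord_recr/= addrA. Qed.

Section fixed_weights.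
Variable c : seq nat -> R.
Hypothesis cT : tree_weights c.

Let c0 u : 0 <= c u. Proof. by have [_ + _ _] := cT; apply. Qed.

Lemma left_end_mono a b u : (a <= b)%N ->
  left_end c (a :: u) <= left_end c (b :: u).
Proof.
move=> /subnK <-; elim: (b - a)%N => // k IH.
by rewrite addSn left_endS; apply: (le_trans IH); rewrite lerDl.
Qed.

Lemma left_end_child a u : left_end c u <= left_end c (a :: u).
Proof. by rewrite /= lerDl sumr_ge0. Qed.

Lemma right_end_child a u :
  left_end c (a :: u) + c (a :: u) <= left_end c u + c u.
Proof. by rewrite -left_endS /= lerD2l; have [_ _ + _] := cT; apply. Qed.

Lemma left_end_ge0 u : 0 <= left_end c u.
Proof.
by elim: u => // a u IH; apply: (le_trans IH); exact: left_end_child.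
Qed.

Lemma right_end_le1 u : left_end c u + c u <= 1.
Proof.
elim: u => [|a u IH]; first by have [/= -> _ _ _] := cT; rewrite add0r.
exact: le_trans (right_end_child a u) IH.
Qed.

Lemma child_unique x a b u :
  left_end c (a :: u) <= x < left_end c (a.+1 :: u) ->
  left_end c (b :: u) <= x < left_end c (b.+1 :: u) -> a = b.
Proof.
move=> /andP[a1 a2] /andP[b1 b2]; apply/eqP; rewrite eqn_leq; apply/andP; split;
  rewrite leqNgt; apply/negP => h.
- by have := left_end_mono u h; rewrite leNgt (le_lt_trans a1 b2).
- by have := left_end_mono u h; rewrite leNgt (le_lt_trans b1 a2).
Qed.

Lemma child_exists x u : left_end c u <= x < left_end c u + c u ->
  exists a, left_end c (a :: u) <= x < left_end c (a.+1 :: u).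
Proof.
move=> /andP[x1 x2].
have e0 : 0 < (left_end c u + c u - x) / 2 by lra.
have [_ _ _ /(_ u _ e0)[n nP]] := cT.
(* The child sought is the predecessor of the least such n; n = 0 is excluded since child 0 starts
   where u does. *)
have ex : exists n, x < left_end c (n :: u) by exists n => /=; lra.
case: (ex_minnP ex) => -[|m] xm mmin; first by move: xm; rewrite /= big_ord0; lra.
exists m; rewrite xm andbT leNgt; apply/negP => /mmin.
by rewrite ltnn.
Qed.

Lemma interval_nodeP x u : 0 <= x < 1 ->
  interval_node c x (size u) = u <-> left_end c u <= x < left_end c u + c u.
Proof.
move=> x01; elim: u => [|a u IH] /=.
  by have [-> _ _ _] := cT; rewrite add0r.
split=> [[+ /IH ux]|h].
  have [b bP] := child_exists ux; rewrite (IH.2 ux).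
  case: xgetP => [a' _ a'P <-|/(_ b)[]//].
  by rewrite -left_endS.
have ux : left_end c u <= x < left_end c u + c u.
  have /andP[h1 h2] := h; rewrite (le_trans (left_end_child a u) h1)/=.
  exact: lt_le_trans h2 (right_end_child a u).
rewrite (IH.2 ux); congr (_ :: _); rewrite -left_endS in h.
by case: xgetP => [b _ bP|/(_ a)[]//]; exact: child_unique bP h.
Qed.

(** The interval at each prefix contains x, hence is nondegenerate. This is what places quantile
    branches in D. *)
Lemma weight_pre_quantile x m : 0 <= x < 1 -> 0 < c (pre (quantile c x) m).
Proof.
move=> x01; rewrite pre_quantile; set u := interval_node c x m.
have um : size u = m by rewrite /u -pre_quantile size_pre.
have : interval_node c x (size u) = u by rewrite um.
by move/(interval_nodeP u x01); lra.
Qed.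

Section branches.
Variables (D : set (nat -> nat)) (t0 : branches D).
Hypothesis cD : forall w, (forall m, 0 < c (pre w m)) -> D w.

(** Points outside [0, 1[ are null but belong to the domain; the constant value t0 there keeps
    preimages of nodes explicit and measurable. *)
Definition quantile_branch (x : measurableTypeR R) : branches D :=
  match pselect (D (quantile c x)) with
  | left h => if 0 <= x < 1 then exist _ _ h else t0
  | right _ => t0
  end.

Lemma quantile_branchE x : 0 <= x < 1 ->
  sval (quantile_branch x) = quantile c x.
Proof.
move=> x01; rewrite /quantile_branch; case: pselect => [h|[]]; first by rewrite x01.
by apply: cD => m; exact: weight_pre_quantile.
Qed.

Lemma quantile_branch_out x : ~ (0 <= x < 1) -> quantile_branch x = t0.
Proof.
by move=> /negP/negbTE h; rewrite /quantile_branch; case: pselect => // ?; rewrite h.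
Qed.

Lemma quantile_branch_node u :
  quantile_branch @^-1` node u `&` `[0, 1[%classic =
  `[left_end c u, left_end c u + c u[%classic.
Proof.
apply/seteqP; split=> [x [/=]|x /=].
  rewrite in_itv/= /node/= => + x01; rewrite quantile_branchE// pre_quantile.
  by move/(interval_nodeP u x01); rewrite in_itv.
rewrite !in_itv/= => xu.
have x01 : 0 <= x < 1.
  by have := left_end_ge0 u; have := right_end_le1 u; lra.
split=> //; rewrite /node/= quantile_branchE// pre_quantile.
exact/interval_nodeP.
Qed.

Lemma quantile_branch_measurable_node u :
  measurable (quantile_branch @^-1` node u).
Proof.
rewrite (_ : _ @^-1` _ = `[left_end c u, left_end c u + c u[%classic `|`
    (if pselect (node u t0) then ~` `[0, 1[%classic else set0)).
  apply: measurableU; first exact: measurable_itv.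
  case: pselect => _ /=; last exact: measurable0.
  by apply: measurableC; exact: measurable_itv.
rewrite -quantile_branch_node; apply/seteqP; split=> x /=.
  have [x01|x01] := pselect (0 <= x < 1).
    by move=> xu; left; rewrite in_itv.
  rewrite quantile_branch_out// => t0u; right.
  by case: pselect => //= _; rewrite in_itv.
case=> [[]//|]; case: pselect => //= t0u; rewrite in_itv/= => x01.
by rewrite quantile_branch_out.
Qed.

Lemma quantile_branch_measurable U :
  open U -> measurable (quantile_branch @^-1` U).
Proof.
exact: (measurable_branches (T := measurableTypeR R)
  quantile_branch_measurable_node).
Qed.

Definition tree_Delta : Delta R (branches D) :=
  Delta_push (@unit_measure R) quantile_branch_measurable.

Lemma tree_Delta_node h u :
  tree_Delta (node u : set (borel h)) = (c u)%:E.
Proof.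
have mn : measurable (node u : set (borel h)).
  by apply: open_borel; exact: open_node.
apply: etrans (Delta_pushE _ _ mn) _.
pose J : set (measurableTypeR R) := `[left_end c u, left_end c u + c u[%classic.
rewrite -[LHS]/(@unit_measure R (quantile_branch @^-1` node u)).
rewrite (@eq_unit_measure _ _ J).
  rewrite unit_measure_itv ?left_end_ge0 ?right_end_le1 ?lerDl//.
  by congr EFin; lra.
by rewrite /J -quantile_branch_node -setIA setIid.
Qed.

End branches.

End fixed_weights.

Lemma left_end_cvg (c_ : nat -> seq nat -> R) c u :
  (forall v, c_ n v @[n --> \oo] --> c v) ->
  left_end (c_ n) u @[n --> \oo] --> left_end c u.
Proof.
move=> cc; elim: u => [|a u IH] /=; first exact: cvg_cst.
apply: cvgD => //; apply: cvg_big => [|b _]; last exact: cc.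
exact: add_continuous.
Qed.

(** A point of a half-open interval is strictly below its right end. Off the countably many left
    ends it is strictly inside, which persists under small changes of the weights. This is a
    Skorokhod coupling of the measures with weights c_ n and c. *)
Lemma quantile_cvg (c_ : nat -> seq nat -> R) c x m :
  (forall n, tree_weights (c_ n)) -> tree_weights c ->
  (forall v, c_ n v @[n --> \oo] --> c v) -> 0 <= x < 1 ->
  (forall u, x <> left_end c u) ->
  \forall n \near \oo, pre (quantile (c_ n) x) m = pre (quantile c x) m.
Proof.
move=> cT_ cT cc x01 xl; rewrite pre_quantile; set u := interval_node c x m.
have um : size u = m by rewrite /u -pre_quantile size_pre.
have : interval_node c x (size u) = u by rewrite um.
move/(interval_nodeP cT u x01) => /andP[x1 x2].
have {}x1 : left_end c u < x by rewrite lt_neqAle x1 andbT eq_sym; exact/eqP.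
have l1 : \forall n \near \oo, left_end (c_ n) u < x.
  exact: (cvgr_lt _ (left_end_cvg (u := u) cc)).
have l2 : \forall n \near \oo, x < left_end (c_ n) u + c_ n u.
  exact: (cvgr_gt _ (cvgD (left_end_cvg (u := u) cc) (cc u))).
near=> n; rewrite pre_quantile -um; apply/(interval_nodeP (cT_ n)) => //.
by apply/andP; split; [apply: ltW|]; near: n.
Unshelve. all: end_near. Qed.

End quantile.

(** * Measurable hulls and selection of words *)

Section hull.
Context d (T : measurableType d) (R : realType) (P : probability T R).
Implicit Types A B C : set T.

(** Intersect a sequence of measurable supersets whose measures tend to the infimum; a further
    superset C cannot cut off positive mass. *)
Lemma hull_exists A : exists B, [/\ measurable B, A `<=` B &
  forall C, measurable C -> A `<=` C -> P (B `\` C) = 0%E].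
Proof.
have fP B : measurable B -> P B \is a fin_num by exact: fin_num_measure.
pose V := [set r : R | exists B, [/\ measurable B, A `<=` B & P B = r%:E]].
have V0 : V !=set0.
  exists (fine (P setT)), setT; split=> //.
  by rewrite fineK//; exact: fP.
have Vlb : has_lbound V.
  by exists 0 => r [B [_ _ PB]]; rewrite -lee_fin -PB measure_ge0.
have HB (n : nat) : exists B, [/\ measurable B, A `<=` B &
    (P B <= (inf V + n.+1%:R^-1)%:E)%E].
  have n0 : 0 < n.+1%:R^-1 :> R by rewrite invr_gt0.
  have [r [B [mB AB PB]] rV] := inf_adherent n0 (conj V0 Vlb).
  by exists B; split=> //; rewrite PB lee_fin ltW.
have [B BP] := choice HB.
have mB : measurable (\bigcap_n B n).
  by apply: bigcapT_measurable => n; have [] := BP n.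
exists (\bigcap_n B n); split=> //.
  by move=> x Ax n _; have [_ AB _] := BP n; exact: AB.
move=> C mC AC.
have mBC : measurable (\bigcap_n B n `&` C) by exact: measurableI.
have h1 : (P (\bigcap_n B n) <= (inf V)%:E)%E.
  apply/lee_addgt0Pr => e e0.
  have [n ne] : exists n : nat, n.+1%:R^-1 <= e.
    exists (Num.truncn e^-1); rewrite -[leRHS]invrK lef_pV2 ?posrE ?invr_gt0//.
    exact/ltW/truncnS_gt.
  have [mBn _ h] := BP n; rewrite -EFinD.
  apply: (@le_trans _ _ (P (B n))).
    apply: le_measure; rewrite ?inE//.
    exact: bigcap_inf.
  by apply: le_trans h _; rewrite lee_fin lerD2l.
have h2 : ((inf V)%:E <= P (\bigcap_n B n `&` C))%E.
  rewrite -(fineK (fP _ mBC)) lee_fin; apply: ge_inf => //.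
  exists (\bigcap_n B n `&` C); split=> //; last by rewrite fineK// fP.
  by move=> x Ax; split; [move=> n _; have [_ AB _] := BP n; exact: AB|exact: AC].
rewrite measureD//; last by rewrite -ge0_fin_numE// fP.
apply/eqP; rewrite eq_le; apply/andP; split.
  by rewrite leeBlDr ?fP// add0e (le_trans h1).
rewrite leeBrDr ?fP// add0e; apply: le_measure; rewrite ?inE//.
Qed.

Definition hull A : set T := sval (cid (hull_exists A)).

Lemma measurable_hull A : measurable (hull A).
Proof. by rewrite /hull; case: cid => B /= []. Qed.

Lemma sub_hull A : A `<=` hull A.
Proof. by rewrite /hull; case: cid => B /= []. Qed.

Lemma hullD A C : measurable C -> A `<=` C -> P (hull A `\` C) = 0%E.
Proof. by rewrite /hull; case: cid => B /= [_ _ +]; apply. Qed.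

(* C is almost contained in every measurable set that contains A. *)
Definition thick A C : Prop :=
  forall B, measurable B -> A `<=` B -> P (C `\` B) = 0%E.

Section selection.
Variable A : seq nat -> set T.

Definition first_hull (u : seq nat) (a : nat) : set T :=
  hull (A (a :: u)) `\` \bigcup_(b < a) hull (A (b :: u)).

(** A measurable replacement for a coding whose cells A u need not be measurable. Points in no hull
    of a child get the default digit 0. *)
Fixpoint select (y : T) (m : nat) : seq nat :=
  if m is m'.+1 then
    let u := select y m' in xget 0%N [set a | first_hull u a y] :: u
  else [::].

Lemma size_select y m : size (select y m) = m.
Proof. by elim: m => //= m ->. Qed.

Lemma first_hull_unique u a b y : first_hull u a y -> first_hull u b y -> a = b.
Proof.
move=> [ya na] [yb nb]; apply/eqP; rewrite eqn_leq; apply/andP; split;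
  rewrite leqNgt; apply/negP => ab; [apply: na|apply: nb].
- by exists b.
- by exists a.
Qed.

Lemma bigcup_first_hull u :
  \bigcup_a first_hull u a = \bigcup_a hull (A (a :: u)).
Proof.
apply/seteqP; split=> [y [a _ [ya _]]|y [a _ ya]]; first by exists a.
have ex : exists a, `[< hull (A (a :: u)) y >] by exists a; exact/asboolP.
case: (ex_minnP ex) => m /asboolP ym mmin; exists m => //; split=> // -[b /= bm yb].
by have := mmin b (asboolT yb); rewrite leqNgt bm.
Qed.

Lemma measurable_first_hull u a : measurable (first_hull u a).
Proof.
apply: measurableD; first exact: measurable_hull.
by apply: bigcup_measurable => b _; exact: measurable_hull.
Qed.

Lemma select_cons u a : [set y | select y (size u).+1 = a :: u] =
  [set y | select y (size u) = u] `&` (first_hull u a `|`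
    (if a == 0%N then ~` (\bigcup_b hull (A (b :: u))) else set0)).
Proof.
apply/seteqP; split=> y /=.
  move=> [+ yu]; rewrite yu; case: xgetP => [b _ yb <-|nb <-].
    by split=> //; left.
  split=> //; right => /=; rewrite -bigcup_first_hull => -[b _ yb].
  exact: nb yb.
move=> [-> h]; congr (_ :: _); case: xgetP => [b _ yb|nb].
  case: h => [ya|]; first exact: first_hull_unique yb ya.
  case: eqP => // _ []; rewrite -bigcup_first_hull; by exists b.
by case: h => [/nb//|]; case: eqP.
Qed.

Lemma measurable_select u : measurable [set y | select y (size u) = u].
Proof.
elim: u => [|a u IH].
  by rewrite (_ : mkset _ = setT)//; apply/seteqP; split.
rewrite select_cons; apply: measurableI => //; apply: measurableU.
  exact: measurable_first_hull.
case: eqP => _; last exact: measurable0.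
by apply: measurableC; apply: bigcupT_measurable => b; exact: measurable_hull.
Qed.

Hypothesis AT : thick (A [::]) setT.
Hypothesis Achild : forall u, A u `<=` \bigcup_a A (a :: u).

(** A point that selects [a :: u] lies in the hull of A (a :: u), or selects u while lying in no
    hull of a child. The second kind is null by induction, as those hulls cover A u; the first is
    null outside any B containing A (a :: u). *)
Lemma thick_select u : thick (A u) [set y | select y (size u) = u].
Proof.
elim: u => [|a u IH] B mB AB.
  rewrite (_ : mkset _ = setT); last by apply/seteqP; split.
  exact: AT.
pose H := \bigcup_a hull (A (a :: u)).
have mH : measurable H by apply: bigcupT_measurable => b; exact: measurable_hull.
have AH : A u `<=` H by move=> y /Achild[b _ /sub_hull yb]; exists b.
have mC : measurable ([set y | select y (size u).+1 = a :: u] `\` B).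
  by apply: measurableD => //; exact: (measurable_select (a :: u)).
apply: measure_negligible => //.
apply: (@negligibleS _ _ _ _ (([set y | select y (size u) = u] `\` H) `|`
    (hull (A (a :: u)) `\` B))); last first.
  apply: negligibleU; apply/negligibleP.
  - by apply: measurableD => //; exact: measurable_select.
  - exact: IH.
  - by apply: measurableD => //; exact: measurable_hull.
  - exact: hullD.
rewrite select_cons => y [[yu h] nB]; case: h => [[ya _]|]; first by right.
by case: eqP => // _ nH; left.
Qed.

End selection.

Lemma eq_select (A A' : seq nat -> set T) m y :
  (forall u, (size u <= m)%N -> A u = A' u) ->
  select A y m = select A' y m.
Proof.
elim: m => //= m IH AA'; rewrite IH => [|u um]; last by apply: AA'; exact: leqW.
have E b : A (b :: select A' y m) = A' (b :: select A' y m).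
  by apply: AA'; rewrite /= ltnS size_select.
have EF a : first_hull A (select A' y m) a = first_hull A' (select A' y m) a.
  rewrite /first_hull E; congr (_ `\` _).
  by apply: eq_bigcupr => b _; rewrite E.
by congr (xget _ _ :: _); apply/funext => a /=; rewrite EF.
Qed.

End hull.

(** * Codes that refer to the distribution of opposing codes *)

Section causal_fixpoint.
Context (R : realType) (X : bool -> topologicalType).
Variable mu : forall i, X i -> Delta R (X (~~ i)).
Arguments mu {i} _.
Variable S : forall i, set (X i).
Variable code : forall i, nat -> X i -> (seq nat -> R) -> nat.
Arguments code {i} _ _ _.
Arguments S i _ : clear implicits.

Local Notation codes := (forall i, X i -> nat -> nat).

Definition family (W : codes) i (u : seq nat) : set (X i) :=
  [set s | S i s /\ pre (W i s) (size u) = u].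

Definition selection (W : codes) i (s : X i) (y : X (~~ i)) (m : nat) : seq nat :=
  select (T := borel (Delta_nonempty (mu s))) (mu s) (@family W (~~ i)) y m.

Definition weight (W : codes) i (s : X i) (u : seq nat) : R :=
  fine (mu s [set y : borel (Delta_nonempty (mu s)) | selection W s y (size u) = u]).

(** Hiding the weights of longer words from entry n is what makes [recode] causal. *)
Definition truncate n (c : seq nat -> R) (u : seq nat) : R :=
  if (size u <= n)%N then c u else 0.

Definition recode (W : codes) : codes :=
  fun i s n => code n s (truncate n (weight W s)).

Lemma recode_causal (W W' : codes) n :
  (forall i s k, (k < n)%N -> W i s k = W' i s k) ->
  forall i (s : X i), recode W s n = recode W' s n :> nat.
Proof.
move=> WW' i s; congr (code _ _ _); apply/funext => u; rewrite /truncate.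
case: ifP => // un; congr (fine (mu s _)).
suff E y : selection W s y (size u) = selection W' s y (size u).
  by apply/funext => y /=; rewrite E.
apply: eq_select => v vu; apply/seteqP; split=> z [Sz zv]; split=> //;
  rewrite -[RHS]zv; apply/pre_eqP => k kv; [apply: esym|]; apply: WW';
  exact: leq_trans kv (leq_trans vu un).
Qed.

Let W0 : codes := fun _ _ _ => 0%N.

(* Entry n of a recoded strategy depends only on entries before n, through the
   weights of the words of length at most n, so n.+1 iterations determine it. *)
Definition fixcode : codes := fun i s n => iter n.+1 recode W0 i s n.

Lemma iter_recode_stable N n i (s : X i) : (n < N)%N ->
  iter N.+1 recode W0 i s n = iter N recode W0 i s n.
Proof.
elim: N n i s => // N IH n i s nN; apply: recode_causal => j t k kn.
apply: IH; exact: leq_trans kn nN.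
Qed.

Lemma iter_recode_fixcode N n i (s : X i) : (n < N)%N ->
  iter N recode W0 i s n = fixcode s n.
Proof.
elim: N => // N IH; rewrite ltnS leq_eqVlt => /orP[/eqP->//|nN].
by rewrite iter_recode_stable// IH.
Qed.

Lemma fixcodeE n i (s : X i) :
  fixcode s n = code n s (truncate n (weight fixcode s)).
Proof.
rewrite /fixcode iterS; apply: recode_causal => j t k kn.
exact: iter_recode_fixcode.
Qed.

Hypothesis outer_S : forall i (s : X i), S i s -> outer_full (mu s) (S (~~ i)).

Section at_strategy.
Variables (i : bool) (s : X i).
Hypothesis Ss : S i s.
Let h := Delta_nonempty (mu s).
Let sel : borel h -> nat -> seq nat := selection fixcode s.
Let c := weight fixcode s.

Lemma measurable_selection u : measurable [set y | sel y (size u) = u].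
Proof. exact: measurable_select. Qed.

Lemma thick_selection u :
  thick (mu s) (@family fixcode (~~ i) u) [set y | sel y (size u) = u].
Proof.
apply: thick_select => [B mB SB|v y [Sy yv]]; last first.
  by exists (fixcode y (size v)) => //; split=> //=; rewrite yv.
have muB : mu s B = 1%E.
  by apply: (outer_S Ss mB) => y Sy; apply: SB.
by rewrite setTD; apply: etrans (probability_setC _ mB) _; rewrite muB subee.
Qed.

(** If no code in the family begins with u, thickness against the empty set makes the selected set
    null. Words of positive weight thus begin actual codes. *)
Lemma weight_family u : 0 < c u -> @family fixcode (~~ i) u !=set0.
Proof.
move=> cu; apply/set0P/eqP => F0; move: cu; rewrite /c /weight.
have := @thick_selection u set0 measurable0; rewrite F0 setD0 => /(_ (@subset_refl _ _)) E.
by rewrite -/h -/sel E ltxx.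
Qed.

Lemma weightE u : mu s [set y | sel y (size u) = u] = (c u)%:E.
Proof.
by rewrite /c /weight fineK//; exact: (fin_num_measure _ _ (measurable_selection u)).
Qed.

Let sel_child u :
  [set y | sel y (size u) = u] = \bigcup_a [set y | sel y (size u).+1 = a :: u].
Proof.
apply/seteqP; split=> y /=; last by move=> [a _ [_ ->]].
by move=> yu; exists (head 0%N (sel y (size u).+1)); rewrite // -[X in _ :: X]yu.
Qed.

Lemma weight_cvg u : \sum_(a < n) c (val a :: u) @[n --> \oo] --> c u.
Proof.
have : (\sum_(0 <= a < n) mu s [set y | sel y (size u).+1 = a :: u])%E
    @[n --> \oo] --> mu s [set y | sel y (size u) = u].
  rewrite sel_child; apply: measure_semi_sigma_additive.
  - by move=> a; exact: (measurable_selection (a :: u)).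
  - by move=> a b _ _ [y [/= -> [->]]].
  - by apply: bigcupT_measurable => a; exact: (measurable_selection (a :: u)).
rewrite weightE; under eq_fun => n.
  under eq_bigr => a _ do rewrite (weightE (a :: u)).
  rewrite sumEFin big_mkord; over.
by move/fine_cvgP => [_].
Qed.

Lemma tree_weights_weight : tree_weights c.
Proof.
have c0 u : 0 <= c u by rewrite /c /weight fine_ge0.
have c_mono u : nondecreasing_seq (fun n => \sum_(a < n) c (val a :: u)).
  by apply/nondecreasing_seqP => n; rewrite big_ord_recr/= lerDl.
split=> [|//|u n|u e e0].
- apply: EFin_inj; rewrite -weightE.
  rewrite (_ : mkset _ = setT); first exact: probability_setT.
  by apply/seteqP; split.
- rewrite -(cvg_lim _ (weight_cvg (u := u)))//.
  apply: (nondecreasing_cvgn_le (c_mono u)).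
  by apply/cvg_ex; exists (c u); exact: weight_cvg.
- have /cvgrPdist_le/(_ _ e0)[n _ /(_ n (leqnn n))] := weight_cvg (u := u).
  by rewrite /= ler_norml => hn; exists n; lra.
Qed.

End at_strategy.

End causal_fixpoint.

(** * Limits, approximate payoffs and compact covers *)

Lemma cvg_le_near (R : realType) (a b : nat -> R) (la lb : R) :
  a @ \oo --> la -> b @ \oo --> lb -> (\forall m \near \oo, a m <= b m) ->
  la <= lb.
Proof.
move=> ala blb ab; apply/ler_addgt0Pr => r r0.
have r2 : 0 < r / 2 by lra.
near \oo => m.
have : `|la - a m| < r / 2 by near: m; move/cvgrPdist_lt : ala; exact.
have : `|lb - b m| < r / 2 by near: m; move/cvgrPdist_lt : blb; exact.
have : a m <= b m by near: m.
by rewrite !ltr_norml; lra.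
Unshelve. all: end_near. Qed.

Lemma eq_cvg_seq (R : realType) (a b : nat -> R) (la lb : R) :
  a =1 b -> la = lb -> b @ \oo --> lb -> a @ \oo --> la.
Proof. by move=> /funext -> ->. Qed.

Lemma eps_small (R : realType) (e : R) : 0 < e -> exists k, (2 ^+ k)^-1 < e.
Proof.
move=> e0; exists (Num.truncn e^-1).+1.
rewrite -[ltRHS]invrK ltf_pV2 ?posrE ?invr_gt0 ?exprn_gt0//.
apply: lt_trans (truncnS_gt _) _.
by rewrite -natrX ltr_nat ltn_expl.
Qed.

Lemma sequential_cvg (R : realType) (Y : topologicalType) (f : Y -> R) (y : Y)
    (V : nat -> set Y) : (forall m, nbhs y (V m)) ->
  (forall u : nat -> Y, (forall m, V m (u m)) -> f (u m) @[m --> \oo] --> f y) ->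
  f @ y --> f y.
Proof.
move=> nV H; apply/cvgrPdist_lt => e e0; apply: contrapT => nE.
have HU m : exists z, V m z /\ e <= `|f y - f z|.
  apply: contrapT => nz; apply: nE; apply: filterS (nV m) => z Vz /=.
  by rewrite ltNge; apply/negP => ez; apply: nz; exists z.
have [u uP] := choice HU.
have /cvgrPdist_lt/(_ _ e0)[m _ /(_ m (leqnn m))] := H u (fun m => (uP m).1).
by rewrite /= ltNge; have [_ ->] := uP m.
Qed.

Lemma baire_payoff (R : realType) (X : bool -> topologicalType)
    (pi : bool -> X false * X true -> R) :
  (forall i, bounded_fun (pi i)) -> (forall i, baire_class_one (pi i)) ->
  forall i, exists (g : nat -> X i -> X (~~ i) -> R) (M : R),
    [/\ forall n, continuous (fun p : X i * X (~~ i) => g n p.1 p.2),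
        forall n s y, `|g n s y| <= M
      & forall s y, g n s y @[n --> \oo] --> payoff pi s y].
Proof.
move=> bpi cpi i.
have [G [M [cG GM Gp]]] : exists (G : nat -> X false * X true -> R) (M : R),
    [/\ forall n, continuous (G n), forall n p, `|G n p| <= M
      & forall p, G n p @[n --> \oo] --> pi i p].
  have [g cg gp] := cpi i; have /bounded_fun_exP[M piM] := bpi i.
  (* The absolute value is taken because M may be negative when there are no strategy pairs. Cutting
     the approximants at this bound leaves the limit unchanged and allows dominated convergence. *)
  have [M0 M1] : - `|M| <= `|M| /\ M <= `|M|.
    by split; [have := normr_ge0 M; lra|exact: ler_norm].
  pose cut (t : R) := Num.max (- `|M|) (Num.min `|M| t).
  have ccut : continuous cut.
    move=> t; apply: (@continuous_max _ _ (cst (- `|M|))); first exact: cvg_cst.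
    by apply: (@continuous_min _ _ (cst `|M|) id); [exact: cvg_cst|exact: cvg_id].
  exists (fun n p => cut (g n p)), `|M|; split.
  - by move=> n p; apply: (cvg_comp (g n) cut); [exact: cg|exact: ccut].
  - move=> n p; rewrite ler_norml /cut le_max lexx/= ge_max M0/=.
    by rewrite ge_min lexx.
  - move=> p; have cutp : cut (pi i p) = pi i p.
      have := piM p; rewrite ler_norml => /andP[p1 p2].
      rewrite /cut (min_idPr _) ?(max_idPr _)//; first lra.
      exact: le_trans M1.
    rewrite -[X in _ --> X]cutp; apply: (cvg_comp _ cut); last exact: ccut.
    exact: gp.
case: i G cG GM Gp {bpi cpi} => G cG GM Gp; last first.
  exists (fun n s y => G n (s, y)), M; split=> // n.
  have -> : (fun p : X false * X true => G n (p.1, p.2)) = G n by apply/funext => -[].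
  exact: cG.
exists (fun n s y => G n (y, s)), M; split=> // n.
have sw := @continuous_pair _ _ _ _ _ (@continuous_snd (X true) (X false))
  (@continuous_fst (X true) (X false)).
by move=> p; exact: (continuous_comp (sw p) (cG n _)).
Qed.

(** Countably many balls, centred in the dense sequence with radii 2^-k and contained in compact
    sets, cover X; L n collects the compact sets chosen for the first n indices. *)
Lemma compact_exhaustion (R : realType) (X : topologicalType)
    (d : X -> X -> R) (e : nat -> X) : polish_metric d e ->
  locally_compact [set: X] ->
  exists L : nat -> set X, (forall n, compact (L n)) /\
    forall x, \forall n \near \oo, L n x.
Proof.
move=> dP lX.
have HC (x : X) : exists C : set X, compact C /\ nbhs x C.
  have [C xC [cC _]] := lX x I.
  by exists C; split=> //; move: xC; rewrite withinET.
pose ball j k := [set y | d (e j) y < (2 ^+ k)^-1].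
have HK (jk : nat * nat) : exists K : set X, compact K /\
    ((exists C, compact C /\ ball jk.1 jk.2 `<=` C) -> ball jk.1 jk.2 `<=` K).
  have [[C [cC bC]]|nC] := pselect (exists C, compact C /\ ball jk.1 jk.2 `<=` C).
    by exists C.
  by exists set0; split=> //; exact: compact0.
have [K KP] := choice HK.
pose c n : nat * nat := odflt (0%N, 0%N) (unpickle n).
exists (fun n => \big[setU/set0]_(m < n) K (c m)); split.
  move=> n; elim/big_ind : _ => [|A B cA cB|m _].
  - exact: compact0.
  - exact: compactU.
  - exact: (KP _).1.
move=> x; have [C [cC xC]] := HC x.
have [r r0 rC] := nbhs_distP dP xC.
have r2 : 0 < r / 2 by lra.
have [k kr] := eps_small r2.
have [j jx] : exists j, d (e j) x < (2 ^+ k)^-1.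
  by apply: (dense_dist dP); rewrite invr_gt0 exprn_gt0.
have bK : ball j k `<=` K (j, k).
  apply: (KP (j, k)).2; exists C; split=> // y jy; apply: rC => /=.
  have := dist_triangle dP (e j) x y; rewrite (dist_sym dP x (e j)) /ball/= in jy *.
  lra.
near=> n; have jkn : (pickle (j, k) < n)%N by near: n; exact: nbhs_infty_gt.
rewrite -(bigcup_mkord n (fun m => K (c m))); exists (pickle (j, k)) => //.
by rewrite /c pickleK; exact: bK.
Unshelve. all: end_near. Qed.

(** * Codes of strategies and the closure of the set of codes *)

Section coding.
Context (R : realType) (X : bool -> topologicalType).
Variable pi : bool -> X false * X true -> R.
Variables (d : forall i, X i -> X i -> R) (e : forall i, nat -> X i).
Hypothesis dP : forall i, polish_metric (@d i) (@e i).
Variable L : forall i, nat -> set (X i).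
Hypothesis L_compact : forall i n, compact (@L i n).
Hypothesis L_cover : forall i (x : X i), \forall n \near \oo, @L i n x.
Variables (g : forall i, nat -> X i -> X (~~ i) -> R) (M : R).
Hypothesis g_cont : forall i n,
  continuous (fun p : X i * X (~~ i) => @g i n p.1 p.2).
Hypothesis g_bound : forall i n s y, `|@g i n s y| <= M.
Hypothesis g_cvg : forall i s y, @g i n s y @[n --> \oo] --> payoff pi s y.
Variables (S : forall i, set (X i)) (mu : forall i, X i -> Delta R (X (~~ i))).
Arguments d {i} _ _.
Arguments e {i} _.
Arguments L {i} _ _.
Arguments g {i} _ _ _.
Arguments S i _ : clear implicits.
Arguments mu {i} _.
Hypothesis outer_S : forall i (s : X i), S i s -> outer_full (mu s) (S (~~ i)).
Hypothesis br_S : forall i (s : X i), S i s -> best_response pi s (mu s).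

Let eps (k : nat) : R := (2 ^+ k)^-1.

Let eps_gt0 k : 0 < eps k.
Proof. by rewrite invr_gt0 exprn_gt0. Qed.

Let le_eps (x y : R) (b : R) : (forall k, x <= y + b * eps k) -> x <= y.
Proof.
move=> h; rewrite leNgt; apply/negP => yx.
pose z := (x - y) / (`|b| + 1).
have b0 := normr_ge0 b.
have z0 : 0 < z by rewrite divr_gt0//; lra.
have [k kz] := eps_small z0.
have zE : z * (`|b| + 1) = x - y by rewrite mulfVK//; lra.
have := h k; have := eps_gt0 k; have := ler_norm b.
rewrite -/(eps k) in kz; nra.
Qed.

Definition expected_approx i (s : X i) (n : nat) (s' : X i) : R :=
  \int[mu s]_y g n s' y.

(* The entry (t, u, k) of the code of a strategy s records: for t = 0, a point of
   the dense sequence within 2^-k of s; for t = 1, the integer part of 2^k c u,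
   where c u is the probability that s assigns to the opponent's codes extending
   u; for t = 2, how many children of u carry c u up to 2^-k, which prevents mass
   from escaping in a limit; for t = 3, a rank from which the approximate payoffs
   of s vary by at most 2^-k; for t = 4, with u = [:: N], a rank m such that the
   approximate payoff of each strategy in the compact set L N exceeds that of s by
   at most 2 * 2^-k at some rank between N and m. Each clause is closed in the
   code, so it survives in the limits that the closure of the codes adds. *)
Definition entry i (x : nat * seq nat * nat) (s : X i) (c : seq nat -> R) : nat :=
  let: (t, u, k) := x in
  let E := expected_approx s in
  let settled := xget 0%N [set m | forall n n', (m <= n)%N -> (m <= n')%N ->
    `|E n s - E n' s| <= eps k] in
  match t with
  | 0 => xget 0%N [set j | d (e j) s < eps k]
  | 1 => Num.truncn (2 ^+ k * c u)
  | 2 => xget 0%N [set b | c u - eps k <= \sum_(a < b) c (val a :: u)]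
  | 3 => settled
  | _ => xget 0%N [set m | forall s', L (head 0%N u) s' ->
      exists n, [/\ (head 0 u <= n)%N, (n <= m)%N &
        E n s' <= E settled s + 2 * eps k]]
  end.

(** The discarded component repeats every entry at infinitely many positions, so that one of them
    comes late enough for the truncated weights to include all those it reads. *)
Definition code i (n : nat) (s : X i) (c : seq nat -> R) : nat :=
  if (unpickle n : option (nat * seq nat * nat * nat)) is Some (x, _)
  then entry x s c else 0%N.
Arguments code {i} _ _ _.

(** The inequality is strict because entries with t = 2 read the weights of the children of u, which
    are one digit longer. *)
Definition position_of (x : nat * seq nat * nat) (N : nat) : Prop :=
  (size x.1.2 < N)%N /\
  exists p : nat, unpickle N = Some (x, p) :> option (nat * seq nat * nat * nat).

Lemma position_exists x : exists N, position_of x N.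
Proof.
pose K := (size x.1.2).+1.
have [p pK] : exists p, (K <= pickle (x, p : nat))%N.
  apply: contrapT => H.
  have lt (p : 'I_K.+1) : (pickle (x, val p) < K)%N.
    by rewrite ltnNge; apply/negP => h; apply: H; exists (val p).
  pose f (p : 'I_K.+1) : 'I_K := Ordinal (lt p).
  have /leq_card : injective f.
    move=> p q /(congr1 val)/= /(pcan_inj pickleK)[pq].
    exact: val_inj.
  by rewrite !card_ord ltnn.
by exists (pickle (x, p)); split=> //; exists p; rewrite pickleK.
Qed.

(* Sealed, as tactics up to conversion would otherwise unfold it. *)
Fact position_subproof : {f | forall x, position_of x (f x)}.
Proof. by have [f fP] := choice position_exists; exists f. Qed.

Definition position : nat * seq nat * nat -> nat := sval position_subproof.

Lemma positionP x : position_of x (position x).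
Proof. exact: (svalP position_subproof). Qed.

Fact strategy_code_subproof : {f | f = fixcode (@mu) S (@code)}.
Proof. by eexists. Qed.

Definition strategy_code i (s : X i) : nat -> nat := sval strategy_code_subproof i s.

Lemma strategy_codeE i (s : X i) : strategy_code s = fixcode (@mu) S (@code) s.
Proof. by rewrite /strategy_code (svalP strategy_code_subproof). Qed.

Definition strategy_weight i (s : X i) : seq nat -> R :=
  weight (@mu) S (fixcode (@mu) S (@code)) s.

Lemma strategy_code_position i (s : X i) x :
  exists2 N, (size x.1.2 < N)%N & strategy_code s (position x) =
    entry x s (truncate N (strategy_weight s)).
Proof.
have [xN [p px]] := positionP x; exists (position x) => //.
by rewrite strategy_codeE fixcodeE /code px.
Qed.

Lemma code_point i (s : X i) k :
  d (e (strategy_code s (position (0, [::], k)))) s < eps k.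
Proof.
have [N _ ->] := strategy_code_position s (0, [::], k) => /=.
case: xgetP => [j _ //|nj].
by have [j jk] := dense_dist (@dP i) s (eps_gt0 k); have := nj j jk.
Qed.

Lemma tree_weights_strategy i (s : X i) : S i s ->
  tree_weights (strategy_weight s).
Proof. by move=> Ss; apply: tree_weights_weight. Qed.

Lemma strategy_weight_gt0 i (s : X i) u : S i s -> 0 < strategy_weight s u ->
  exists2 y, S (~~ i) y & pre (strategy_code y) (size u) = u.
Proof.
move=> Ss /(weight_family outer_S Ss)[y [Sy yu]]; exists y => //.
by rewrite strategy_codeE.
Qed.

Lemma code_weight i (s : X i) u k : S i s ->
  (strategy_code s (position (1, u, k)))%:R * eps k <= strategy_weight s u
    < (strategy_code s (position (1, u, k)))%:R * eps k + eps k.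
Proof.
move=> Ss; have [N /= uN ->] := strategy_code_position s (1, u, k).
have [_ c0 _ _] := tree_weights_strategy Ss.
rewrite /= /truncate (ltnW uN).
set c := strategy_weight s u.
have p0 : 0 < 2 ^+ k :> R by exact: exprn_gt0.
have cc0 : 0 <= 2 ^+ k * c by apply: mulr_ge0; [exact: ltW|exact: c0].
have /andP[h1 h2] := truncn_itv cc0.
rewrite ler_pdivrMr// [c * _]mulrC h1/= -[X in _ + X]mul1r -mulrDl ltr_pdivlMr//.
by rewrite [c * _]mulrC natr1.
Qed.

Lemma code_children i (s : X i) u k : S i s ->
  strategy_weight s u - eps k <=
  \sum_(a < strategy_code s (position (2, u, k))) strategy_weight s (val a :: u).
Proof.
move=> Ss; have [N /= uN ->] := strategy_code_position s (2, u, k) => /=.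
have E b : \sum_(a < b) truncate N (strategy_weight s) (val a :: u) =
    \sum_(a < b) strategy_weight s (val a :: u).
  by apply: eq_bigr => a _; rewrite /truncate/= uN.
case: xgetP => [b _ /=|nb].
  by rewrite E {1}/truncate (ltnW uN).
have [_ _ _ /(_ u _ (eps_gt0 k))[b bP]] := tree_weights_strategy Ss.
by exfalso; apply: (nb b); rewrite /= E {1}/truncate (ltnW uN).
Qed.

Lemma eps_le k m : (k <= m)%N -> eps m <= eps k.
Proof.
move=> km; rewrite lef_pV2 ?posrE ?exprn_gt0//.
by rewrite ler_weXn2l// ler1n.
Qed.

Lemma dist_cvg i (u : nat -> X i) x : (forall m, d x (u m) < eps m) ->
  u @ \oo --> x.
Proof.
move=> ux A /(nbhs_distP (@dP i))[r r0 rA]; have [k kr] := eps_small r0.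
suff : \forall m \near \oo, A (u m) by [].
near=> m; apply: rA => /=; apply: (lt_le_trans (ux m)).
apply: le_trans (ltW kr); apply: eps_le; near: m; exact: nbhs_infty_ge.
Unshelve. all: end_near. Qed.

Lemma g_cvg_seq i n (u : nat -> X i) s (v : nat -> X (~~ i)) y :
  u @ \oo --> s -> v @ \oo --> y -> g n (u m) (v m) @[m --> \oo] --> g n s y.
Proof. by move=> us vy; exact: (cvg_comp _ _ (cvg_pair us vy) (@g_cont i n (s, y))). Qed.

Lemma g_continuous i n (s : X i) : continuous (g n s).
Proof.
move=> y; exact: (cvg_comp _ _ (cvg_pair (cvg_cst s) cvg_id) (@g_cont i n (s, y))).
Qed.

Lemma payoff_measurable i (s : X i) h :
  measurable_fun setT (payoff pi s : borel h -> R).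
Proof.
apply: (@measurable_fun_cvg _ (borel h) _ _ (fun n => g n s : borel h -> R)).
  by move=> n; apply: continuous_borel; exact: g_continuous.
by move=> y _; exact: g_cvg.
Qed.

Lemma expected_payoff_cvg i (nu : Delta R (X (~~ i))) (s' : X i) :
  \int[nu]_y g n s' y @[n --> \oo] --> expected_payoff pi s' nu.
Proof.
apply: (@dominated_Rintegral _ _ _ nu _ _ M).
- by move=> n; apply: continuous_borel; exact: g_continuous.
- exact: payoff_measurable.
- by move=> n y; exact: g_bound.
- by apply: aeW => y; exact: g_cvg.
Qed.

Lemma expected_approx_cvg i (s s' : X i) :
  expected_approx s n s' @[n --> \oo] --> expected_payoff pi s' (mu s).
Proof. exact: expected_payoff_cvg. Qed.

Lemma expected_approx_continuous i (s : X i) n : continuous (expected_approx s n).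
Proof.
move=> s'; apply: (@sequential_cvg _ _ _ _ (fun m => [set t | d s' t < eps m])).
  by move=> m; exact: (nbhs_ball_dist (@dP i)).
move=> u us'; apply: (@dominated_Rintegral _ _ _ (mu s) _ _ M).
- by move=> m; apply: continuous_borel; exact: g_continuous.
- by apply: continuous_borel; exact: g_continuous.
- by move=> m y; exact: g_bound.
- by apply: aeW => y; apply: g_cvg_seq; [exact: dist_cvg|exact: cvg_cst].
Qed.

Let settled i (s : X i) k := strategy_code s (position (3, [::], k)).

Lemma code_settled i (s : X i) k n n' :
  (settled s k <= n)%N -> (settled s k <= n')%N ->
  `|expected_approx s n s - expected_approx s n' s| <= eps k.
Proof.
rewrite /settled; have [N _ ->] := strategy_code_position s (3, [::], k) => /=.
case: xgetP => [m _ mP|nm]; first exact: mP.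
have e2 : 0 < eps k / 2 by have := eps_gt0 k; lra.
have /cvgrPdist_lt/(_ _ e2)[m _ mP] := @expected_approx_cvg _ s s.
exfalso; apply: (nm m) => a b ma mb.
by have := mP a ma; have := mP b mb; rewrite /= !ltr_norml ler_norml; lra.
Qed.

Lemma settled_le i (s : X i) k :
  expected_payoff pi s (mu s) <= expected_approx s (settled s k) s + eps k.
Proof.
rewrite -(cvg_lim _ (@expected_approx_cvg _ s s))//; apply: limr_le.
  by apply/cvg_ex; eexists; exact: expected_approx_cvg.
near=> n; have := @code_settled i s k (settled s k) n (leqnn _).
have sn : (settled s k <= n)%N by near: n; exact: nbhs_infty_ge.
by move=> /(_ sn); rewrite ler_norml; lra.
Unshelve. all: end_near. Qed.

(** The settled rank costs one [eps k]; the second makes the inequality strict, so each competitor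
    satisfies it at some rank beyond N and on a neighbourhood. Compactness of L N bounds these
    ranks, so the default of [xget] is not reached. *)
Lemma code_best_response i (s : X i) k N s' : S i s -> L N s' ->
  exists n, [/\ (N <= n)%N,
    (n <= strategy_code s (position (4, [:: N], k)))%N
  & expected_approx s n s' <= expected_approx s (settled s k) s + 2 * eps k].
Proof.
move=> Ss; have sE := settled_le s k.
rewrite /settled in sE *; have [N3 _ E3] := strategy_code_position s (3, [::], k).
rewrite /= in E3; rewrite E3 in sE *.
have [N4 _ ->] := strategy_code_position s (4, [:: N], k) => /=.
set m3 := xget _ _ in sE *.
case: xgetP => [m _ mP /mP//|nm].
have /compact_near_coveringP cL := @L_compact i N.
pose P n t := exists n', [/\ (N <= n')%N, (n' <= n)%N &
  expected_approx s n' t <= expected_approx s m3 s + 2 * eps k].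
have [|m _ mP] := cL nat \oo P _.
  move=> t _.
  have e1 := eps_gt0 k.
  have : expected_payoff pi t (mu s) < expected_approx s m3 s + 2 * eps k.
    by have := br_S Ss t; lra.
  move=> /(cvgr_lt _ (@expected_approx_cvg _ s t))[n0 _ n0P].
  pose n := maxn n0 N.
  have nt : expected_approx s n t < expected_approx s m3 s + 2 * eps k.
    by apply: n0P; exact: leq_maxl.
  exists ([set t' | expected_approx s n t' < expected_approx s m3 s + 2 * eps k],
    [set n' | (n <= n')%N]) => [|[t' n'] /= [h nn']].
    split; last by exists n.
    exact: (cvgr_lt _ (@expected_approx_continuous i s n t)).
  by exists n; split=> //; [exact: leq_maxr|exact: ltW].
by exfalso; apply: (nm m) => t Lt; exact: (mP m (leqnn m) t Lt).
Qed.

Definition codes i : set (nat -> nat) :=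
  [set w | forall m, exists2 s, S i s & pre (strategy_code s) m = pre w m].

Lemma codes_closed i w :
  (forall m, exists2 w', codes i w' & pre w' m = pre w m) -> codes i w.
Proof.
move=> h m; have [w' /(_ m)[s Ss sw'] w'w] := h m.
by exists s => //; rewrite sw'.
Qed.

Local Notation Theta i := (branches (codes i)).

Lemma strategy_code_codes i (s : X i) : S i s -> codes i (strategy_code s).
Proof. by move=> Ss m; exists s. Qed.

Definition theta i (s : X i) (Ss : S i s) : Theta i :=
  exist _ (strategy_code s) (strategy_code_codes Ss).

Lemma theta_approx i (t : Theta i) N :
  exists2 s, S i s & forall n, (n <= N)%N -> strategy_code s n = sval t n.
Proof.
have [s Ss /pre_eqP h] := svalP t N.+1.
by exists s => // n nN; exact: h.
Qed.

Lemma theta_cvg i (t : Theta i) : exists (s_ : nat -> X i)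
  (Ss_ : forall m, S i (s_ m)), (fun m => theta (Ss_ m)) @ \oo --> t.
Proof.
have [s_ sP] := choice (fun m => let: ex_intro2 s Ss st := svalP t m in
  ex_intro (fun s => S i s /\ pre (strategy_code s) m = pre (sval t) m) s (conj Ss st)).
exists s_, (fun m => (sP m).1) => U /nbhs_branchesP[m mU].
exists m => // n /= mn; apply: mU; rewrite /node/= size_pre.
exact: pre_le mn (sP n).2.
Qed.

Lemma cvg_theta_nat i (t_ : nat -> Theta i) (t : Theta i) N : t_ @ \oo --> t ->
  \forall m \near \oo, sval (t_ m) N = sval t N.
Proof.
move=> tt; have := tt _ (nbhs_node t N.+1).
move=> [m0 _ h]; exists m0 => // m m0m; have := h m m0m.
by rewrite /node/= size_pre => -[].
Qed.

Let point i (t : Theta i) k : X i := e (sval t (position (0, [::], k))).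

Let point_dist i (t : Theta i) k k' : d (point t k) (point t k') <= eps k + eps k'.
Proof.
have [s Ss st] := theta_approx t
  (maxn (position (0, [::], k)) (position (0, [::], k'))).
rewrite /point -!st ?leq_maxl ?leq_maxr//.
have := code_point s k; have := code_point s k'.
set y := e (strategy_code s (position (0, [::], k))).
set z := e (strategy_code s (position (0, [::], k'))) => zs ys.
apply: le_trans (dist_triangle (@dP i) s y z) _.
by rewrite (dist_sym (@dP i) s z) lerD// ltW.
Qed.

Lemma sigma_exists i (t : Theta i) : exists x, forall k, d (point t k) x <= eps k.
Proof.
have [_ _ complete _] := @dP i.
have [|x xP] := complete (point t).
  move=> r r0; have r2 : 0 < r / 2 by lra.
  have [k kr] := eps_small r2; exists k => m n km kn.
  have := point_dist t m n; have := eps_le km; have := eps_le kn.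
  rewrite -/(eps k) in kr; lra.
(* One [eps j] is the distance from a late recorded point to x, the other bounds the precision of
   that point. *)
exists x => k; apply: (@le_eps _ _ 2) => j.
have := xP _ (nbhs_ball_dist (@dP i) x (eps_gt0 j)).
move=> [m0 _ h]; have := h (maxn m0 j) (leq_maxl _ _); rewrite /= => mj.
have := point_dist t k (maxn m0 j); have := eps_le (leq_maxr m0 j).
have := dist_triangle (@dP i) (point t (maxn m0 j)) (point t k) x.
rewrite (dist_sym (@dP i) (point t (maxn m0 j)) x); lra.
Qed.

Definition sigma i (t : Theta i) : X i := sval (cid (sigma_exists t)).

Lemma sigmaP i (t : Theta i) k : d (point t k) (sigma t) <= eps k.
Proof. by rewrite /sigma; case: cid. Qed.

Lemma sigma_unique i (t : Theta i) x : (forall k, d (point t k) x <= eps k) ->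
  sigma t = x.
Proof.
move=> h; apply: (dist0 (@dP i)); apply/eqP; rewrite eq_le (dist_ge0 (@dP i)) andbT.
apply: (@le_eps _ _ 2) => k; have := h k; have := sigmaP t k.
have := dist_triangle (@dP i) (point t k) (sigma t) x.
rewrite (dist_sym (@dP i) (sigma t) (point t k)); lra.
Qed.

Lemma sigma_theta i (s : X i) (Ss : S i s) : sigma (theta Ss) = s.
Proof. by apply: sigma_unique => k; apply: ltW; exact: code_point. Qed.

Lemma sigma_continuous i : continuous (@sigma i).
Proof.
move=> t U /(nbhs_distP (@dP i))[r r0 rU].
have r2 : 0 < r / 2 by lra.
have [k kr] := eps_small r2; rewrite -/(eps k) in kr.
exists (position (0, [::], k)).+1 => t'; rewrite /node/= size_pre => -[tt' _].
apply: rU => /=; have := sigmaP t k; have := sigmaP t' k.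
rewrite /point tt'; set y := e _.
have := dist_triangle (@dP i) y (sigma t) (sigma t').
rewrite (dist_sym (@dP i) (sigma t) y); lra.
Qed.

Let digit i (t : Theta i) u k : R := (sval t (position (1, u, k)))%:R * eps k.

(** Each digit approximates the weight from below within [eps k]. The inequalities between digits
    involve two entries at a time, so they hold throughout the closure. *)
Definition theta_weight i (t : Theta i) (u : seq nat) : R := sup (range (digit t u)).

Let digit_le i (t : Theta i) u k k' : digit t u k <= digit t u k' + eps k'.
Proof.
have [s Ss st] := theta_approx t
  (maxn (position (1, u, k)) (position (1, u, k'))).
rewrite /digit -!st ?leq_maxl ?leq_maxr//.
have := code_weight u k Ss; have := code_weight u k' Ss; lra.
Qed.

Lemma theta_weightP i (t : Theta i) u k :
  digit t u k <= theta_weight t u <= digit t u k + eps k.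
Proof.
apply/andP; split.
  apply: ub_le_sup; last by exists k.
  by exists (digit t u k + eps k) => _ [k' _ <-]; exact: digit_le.
apply: ge_sup; first by exists (digit t u k), k.
by move=> _ [k' _ <-]; exact: digit_le.
Qed.

Lemma theta_weight_theta i (s : X i) (Ss : S i s) :
  theta_weight (theta Ss) = strategy_weight s.
Proof.
apply/funext => u; apply/eqP; rewrite eq_le; apply/andP; split;
  apply: (@le_eps _ _ 1) => k; have := theta_weightP (theta Ss) u k;
  have := code_weight u k Ss; rewrite /digit /=; lra.
Qed.

Lemma theta_weight_cvg i (t_ : nat -> Theta i) (t : Theta i) u : t_ @ \oo --> t ->
  theta_weight (t_ m) u @[m --> \oo] --> theta_weight t u.
Proof.
move=> tt; apply/cvgrPdist_lt => r r0; have [k kr] := eps_small r0.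
rewrite -/(eps k) in kr.
apply: filterS (cvg_theta_nat (position (1, u, k)) tt) => m mt.
have := theta_weightP (t_ m) u k; have := theta_weightP t u k.
by rewrite /digit mt ltr_norml; lra.
Qed.

Lemma theta_weight_near i (t : Theta i) u r : 0 < r ->
  exists s (Ss : S i s), `|theta_weight t u - strategy_weight s u| < r.
Proof.
move=> r0; have [s_ [Ss_ cv]] := theta_cvg t.
have /cvgrPdist_lt/(_ _ r0)[m _ /(_ m (leqnn m))] := theta_weight_cvg (u := u) cv.
by rewrite /= theta_weight_theta => h; exists (s_ m), (Ss_ m).
Qed.

Lemma theta_weight_sum_cvg i (t_ : nat -> Theta i) (t : Theta i) u b : t_ @ \oo --> t ->
  \sum_(a < b) theta_weight (t_ m) (val a :: u) @[m --> \oo] -->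
  \sum_(a < b) theta_weight t (val a :: u).
Proof.
move=> tt; apply: cvg_big => [|a _]; first exact: add_continuous.
exact: theta_weight_cvg.
Qed.

Lemma tree_weights_theta i (t : Theta i) : tree_weights (theta_weight t).
Proof.
have [s_ [Ss_ cv]] := theta_cvg t.
have cw u : theta_weight (theta (Ss_ m)) u @[m --> \oo] --> theta_weight t u.
  exact: theta_weight_cvg.
have cs u b : \sum_(a < b) theta_weight (theta (Ss_ m)) (val a :: u) @[m --> \oo]
    --> \sum_(a < b) theta_weight t (val a :: u) by exact: theta_weight_sum_cvg.
have tw m : tree_weights (theta_weight (theta (Ss_ m))).
  by rewrite theta_weight_theta; exact: (tree_weights_strategy (Ss_ m)).
split.
- have c1 : cst (1 : R) @ \oo --> (1 : R) by exact: cvg_cst.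
  by apply/eqP; rewrite eq_le; apply/andP; split;
    [apply: (cvg_le_near (cw [::]) c1)|apply: (cvg_le_near c1 (cw [::]))];
    apply: nearW => m; have [-> _ _ _] := tw m.
- move=> u; have c0 : cst (0 : R) @ \oo --> (0 : R) by exact: cvg_cst.
  by apply: (cvg_le_near c0 (cw u)); apply: nearW => m; have [_ + _ _] := tw m; exact.
- move=> u b; apply: (cvg_le_near (cs u b) (cw u)); apply: nearW => m.
  by have [_ _ + _] := tw m; exact.
(* The number of children is read off t itself; approximating strategies eventually record the same
   number, so one finite sum serves them all. *)
- move=> u r r0; have [k kr] := eps_small r0; rewrite -/(eps k) in kr.
  exists (sval t (position (2, u, k))).
  have c1 : theta_weight (theta (Ss_ m)) u - r @[m --> \oo] --> theta_weight t u - r.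
    by apply: cvgB; [exact: cw|exact: cvg_cst].
  apply: (cvg_le_near c1 (cs u _)).
  apply: filterS (cvg_theta_nat (position (2, u, k)) cv) => m <-.
  rewrite theta_weight_theta; have := code_children u k (Ss_ m); rewrite /=; lra.
Qed.

(** An approximating strategy also gives positive weight to the prefix at hand, which therefore
    begins the code of some opposing strategy. Hence v is in the closure. *)
Lemma theta_weight_codes i (t : Theta i) v :
  (forall m, 0 < theta_weight t (pre v m)) -> codes (~~ i) v.
Proof.
move=> tv m; have [s [Ss]] := theta_weight_near t (pre v m) (tv m).
rewrite ltr_norml => h.
have : 0 < strategy_weight s (pre v m) by lra.
by move=> /(strategy_weight_gt0 Ss)[y Sy]; rewrite size_pre => yv; exists y.
Qed.

Lemma opponent_code i (t : Theta i) : exists t' : Theta (~~ i), True.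
Proof.
have [s Ss _] := theta_approx t 0.
have [c1 _ _ _] := tree_weights_strategy Ss.
have [|y Sy _] := @strategy_weight_gt0 _ s [::] Ss; first by rewrite c1.
by exists (theta Sy).
Qed.

Definition some_opponent i (t : Theta i) : Theta (~~ i) := sval (cid (opponent_code t)).

Definition beta i (t : Theta i) : Delta R (Theta (~~ i)) :=
  tree_Delta (tree_weights_theta t) (some_opponent t) (@theta_weight_codes i t).

Let quant i (t : Theta i) : measurableTypeR R -> Theta (~~ i) :=
  quantile_branch (theta_weight t) (some_opponent t).

Lemma Rintegral_beta i (t : Theta i) (f : Theta (~~ i) -> R) b :
  continuous f -> (forall v, `|f v| <= b) ->
  \int[beta t]_v f v = \int[@unit_measure R]_x f (quant t x).
Proof. exact: Rintegral_push. Qed.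

Lemma quant_cvg i (t_ : nat -> Theta i) (t : Theta i) : t_ @ \oo --> t ->
  {ae @unit_measure R, forall x, quant (t_ m) x @[m --> \oo] --> quant t x}.
Proof.
move=> tt.
have h1 := unit_measure_ae_neq (fun n => left_end (theta_weight t)
  (odflt [::] (unpickle n))).
have h2 : {ae @unit_measure R, forall x, 0 <= x < 1} by exact: unit_measure_ae.
have FF := ae_filter_ringOfSetsType (@unit_measure R).
apply: filterS2 h2 h1 => x x01 xl U /nbhs_branchesP[m mU].
have xl' u : x <> left_end (theta_weight t) u.
  by have := xl (pickle u); rewrite pickleK.
have := quantile_cvg m (fun n => tree_weights_theta (t_ n)) (tree_weights_theta t)
  (fun v => theta_weight_cvg (u := v) tt) x01 xl'.
apply: filterS => n E; apply: mU; rewrite /node/= size_pre.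
have q s : sval (quant s x) = quantile (theta_weight s) x.
  apply: quantile_branchE x01; first exact: tree_weights_theta.
  exact: theta_weight_codes.
by rewrite !q.
Qed.

(** The quantile coupling reduces this to almost everywhere convergence on one space. Letting the
    integrand vary allows the strategy in the payoff to move together with the state. *)
Lemma beta_cvg_seq i (t_ : nat -> Theta i) (t : Theta i)
    (f_ : nat -> Theta (~~ i) -> R) (f : Theta (~~ i) -> R) (b : R) :
  t_ @ \oo --> t -> (forall m, continuous (f_ m)) -> continuous f ->
  (forall m v, `|f_ m v| <= b) -> (forall v, `|f v| <= b) ->
  (forall (v_ : nat -> Theta (~~ i)) v, v_ @ \oo --> v ->
    f_ m (v_ m) @[m --> \oo] --> f v) ->
  \int[beta (t_ m)]_v f_ m v @[m --> \oo] --> \int[beta t]_v f v.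
Proof.
move=> tt cf_ cf f_b fb ff.
have E m := @Rintegral_beta i (t_ m) (f_ m) b (cf_ m) (f_b m).
have E0 := @Rintegral_beta i t f b cf fb.
apply: (@eq_cvg_seq R (fun m => \int[beta (t_ m)]_v f_ m v)
  (fun m => \int[@unit_measure R]_x f_ m (quant (t_ m) x)) _ _ E E0).
have mq (s : Theta i) (h : Theta (~~ i) -> R) : continuous h ->
    measurable_fun setT (fun x => h (quant s x)).
  move=> ch; have hN : [set: Theta (~~ i)] !=set0 by exists (some_opponent s).
  have mh : measurable_fun setT (h : borel hN -> R) by exact: continuous_borel.
  apply: (measurableT_comp mh); apply: borel_measurability => U oU.
  exact: (quantile_branch_measurable (tree_weights_theta s) (some_opponent s)
    (@theta_weight_codes i s) oU).
apply: (@dominated_Rintegral _ _ _ (@unit_measure R) _ _ b).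
- by move=> n; exact: mq.
- exact: mq.
- by move=> n x; exact: f_b.
- by apply: filterS (quant_cvg tt) => x; exact: ff.
Qed.

Lemma beta_continuous i : continuous (@beta i).
Proof.
move=> t; have FN : Filter (nbhs t) := @nbhs_filter _ t.
have FF : Filter (@beta i @ t) := fmap_filter (@beta i) FN.
apply/Delta_cvgP => f cf /bounded_fun_exP[b fb].
apply: (@sequential_cvg R (Theta i) (fun t : Theta i => \int[beta t]_v f v) t
  (fun m => node (pre (sval t) m))) => [m|t_ tt].
  exact: nbhs_node.
apply: (beta_cvg_seq (b := b)) => // [|v_ v vv].
  move=> U /nbhs_branchesP[m mU]; exists m => // n /= mn; apply: mU.
  rewrite /node/= size_pre; apply: pre_le mn _.
  by have := tt n; rewrite /node/= size_pre.
exact: (cvg_comp _ _ vv (cf v)).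
Qed.

Lemma beta_tight i (t : Theta i) : exists K : nat -> set (Theta (~~ i)),
  (forall n, compact (K n)) /\ full_measure (beta t) (\bigcup_n K n).
Proof. by apply: branches_tight; exact: codes_closed. Qed.

(** * The belief of a coded strategy projects to its original belief *)

Section strategy_belief.
Variables (i : bool) (s : X i).
Hypothesis Ss : S i s.

Let Y := borel (Delta_nonempty (mu s)).

Let sel : Y -> nat -> seq nat := selection (@mu) S (fixcode (@mu) S (@code)) s.

Let kap (y : Y) (n : nat) : nat := head 0%N (sel y n.+1).

Let pre_kap y m : pre (kap y) m = sel y m.
Proof. by elim: m => //= m ->. Qed.

Let good (u : seq nat) : Prop :=
  exists2 y, S (~~ i) y & pre (strategy_code y) (size u) = u.

Let selected u : set Y := [set y | sel y (size u) = u].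

Let measurable_selected u : measurable (selected u).
Proof. exact: measurable_selection. Qed.

Let selected_bad u : ~ good u -> mu s (selected u) = 0%E.
Proof.
move=> bu; have [_ /(_ u) c0 _ _] := tree_weights_strategy Ss.
have E : mu s (selected u) = (strategy_weight s u)%:E by exact: weightE.
rewrite E; congr EFin; apply/eqP; rewrite eq_le c0 andbT leNgt; apply/negP.
by move=> /(strategy_weight_gt0 Ss).
Qed.

Let nth_node (n : nat) : seq nat := odflt [::] (unpickle n).

Let nth_nodeE u : nth_node (pickle u) = u.
Proof. by rewrite /nth_node pickleK. Qed.

(** Null, because such a selected sequence has a prefix that begins no code; such prefixes are
    countable in number and have weight 0. *)
Let bad : set Y := [set y | ~ codes (~~ i) (kap y)].

Let badE : bad = \bigcup_n
  (if `[< good (nth_node n) >] then set0 else selected (nth_node n)).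
Proof.
apply/seteqP; split=> [y ny|y [n _ /=]]; last first.
  move: (nth_node n) => u; case: asboolP => // nu; rewrite /selected/= => yu cy.
  apply: nu; have [z Sz zy] := cy (size u).
  by exists z => //; rewrite zy pre_kap.
have [m nm] : exists m, ~ good (pre (kap y) m).
  apply: contrapT => H; apply: ny => m.
  have [z Sz] : good (pre (kap y) m).
    by apply: contrapT => ng; apply: H; exists m.
  by rewrite size_pre => zy; exists z.
exists (pickle (pre (kap y) m)) => //; rewrite nth_nodeE asboolF//.
by rewrite /selected/= size_pre pre_kap.
Qed.

Let measurable_bad : measurable bad.
Proof.
rewrite badE; apply: bigcupT_measurable => n /=.
by case: ifP => _; [exact: measurable0|exact: measurable_selected].
Qed.

Let bad0 : (mu s).-negligible bad.
Proof.
rewrite badE; apply: negligible_bigcup => n /=.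
case: asboolP => ug; first exact: negligible_set0.
by apply/negligibleP; [exact: measurable_selected|exact: selected_bad].
Qed.

(** Words are reversed, so for u of length [position (0, [::], k)] plus one the head is the entry
    recording a point within [eps k]. Strategies whose code begins with u lie in the closed ball
    around that point, and thickness makes the rest of the selected set null. *)
Let far k u : set Y :=
  selected u `\` [set y : X (~~ i) | d (e (head 0%N u)) y <= eps k].

Let far0 k u : size u = (position (0, [::], k)).+1 -> (mu s).-negligible (far k u).
Proof.
move=> su; have mball : measurable
    ([set y : X (~~ i) | d (e (head 0%N u)) y <= eps k] : set Y).
  apply: closed_borel.
  have /continuous_closedP cd :=
    @dist_continuous _ _ _ _ (@dP (~~ i)) (e (head 0%N u)).
  by apply: (cd [set r | r <= eps k]); exact: closed_le.
apply/negligibleP; first by apply: measurableD => //; exact: measurable_selected.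
apply: (thick_selection outer_S Ss mball).
move=> y [Sy]; rewrite su -strategy_codeE /= => <-.
exact: ltW (code_point _ _).
Qed.

Let t0 : Theta (~~ i) := some_opponent (theta Ss).

Let kbranch (y : Y) : Theta (~~ i) :=
  match pselect (codes (~~ i) (kap y)) with
  | left h => exist _ (kap y) h
  | right _ => t0
  end.

Let kbranchE y : ~ bad y -> sval (kbranch y) = kap y.
Proof. by rewrite /bad/= /kbranch => /contrapT; case: pselect. Qed.

Let kbranch_node u : kbranch @^-1` node u = (selected u `\` bad) `|`
  (if `[< node u t0 >] then bad else set0).
Proof.
apply/seteqP; split=> y.
  have [by_|ny] := pselect (bad y); last first.
    move=> yu; left; split=> //; rewrite /selected/= -pre_kap -(kbranchE ny).
    exact: yu.
  rewrite /= /kbranch; case: pselect => //= _ t0u; right.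
  by rewrite asboolT.
move=> [[yu ny]|]; first by rewrite /= /node/= kbranchE// pre_kap.
case: asboolP => //= t0u by_; rewrite /kbranch; case: pselect => //.
Qed.

Let measurable_kbranch U : open U -> measurable (kbranch @^-1` U).
Proof.
apply: measurable_branches => u; rewrite kbranch_node; apply: measurableU.
  by apply: measurableD; [exact: measurable_selected|exact: measurable_bad].
by case: ifP => _; [exact: measurable_bad|exact: measurable0].
Qed.

Let beta_theta : beta (theta Ss) = Delta_push (mu s) measurable_kbranch.
Proof.
apply: (Delta_eq_base (@nodes_open _) (@nodes_setI _) (@nodes_base _)).
move=> _ [->|[u ->]]; first exact: etrans (measure0 _) (esym (measure0 _)).
have mn (h : [set: Theta (~~ i)] !=set0) : measurable (node u : set (borel h)).
  by apply: open_borel; exact: open_node.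
have -> : beta (theta Ss) (node u) = (theta_weight (theta Ss) u)%:E.
  have hT : [set: Theta (~~ i)] !=set0 by exists t0.
  exact: (tree_Delta_node _ _ _ hT u).
pose hN := Delta_nonempty (Delta_push (mu s) measurable_kbranch).
apply: esym; apply: etrans (Delta_pushE _ _ (mn hN)) _.
rewrite theta_weight_theta.
have <- : mu s (selected u) = (strategy_weight s u)%:E by exact: weightE.
apply: (probability_eq_off_null _ _ bad0).
- by apply: measurable_kbranch; exact: open_node.
- exact: measurable_selected.
- move=> y ny; rewrite kbranch_node; split; last by left.
  by case=> [[]//|]; case: asboolP.
Qed.

(** Off the null sets [bad] and [far], the points recorded in the code selected for y converge to y,
    so [sigma] returns y even if that code is not the code of y. *)
Lemma Delta_map_sigma_beta (cs : continuous (@sigma (~~ i))) :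
  Delta_map cs (beta (theta Ss)) = mu s.
Proof.
apply: Delta_ext => h A mA.
apply: etrans (Delta_mapE cs _ mA) _.
rewrite beta_theta.
pose hN := Delta_nonempty (Delta_push (mu s) measurable_kbranch).
have mA' := @Delta_preimage _ _ _ cs hN _ _ mA.
apply: etrans (Delta_pushE _ _ mA') _.
pose N := bad `|` \bigcup_k \bigcup_n
  (if size (nth_node n) == (position (0, [::], k)).+1 then far k (nth_node n)
   else set0).
have N0 : (mu s).-negligible N.
  apply: negligibleU; first exact: bad0.
  apply: negligible_bigcup => k; apply: negligible_bigcup => n /=.
  by case: eqP => uk; [exact: far0|exact: negligible_set0].
have E y : ~ N y -> sigma (kbranch y) = y.
  move=> ny; have nby : ~ bad y by move=> by_; apply: ny; left.
  apply: sigma_unique => k; rewrite /point (kbranchE nby).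
  apply: contrapT => nd; apply: ny; right; exists k => //.
  pose u := pre (kap y) (position (0, [::], k)).+1.
  exists (pickle u) => //; rewrite nth_nodeE size_pre eqxx.
  have yu : sel y (size u) = u by rewrite /u size_pre -pre_kap.
  by split.
apply: (probability_eq_off_null _ _ N0).
- rewrite -[X in measurable X]setTI.
  by apply: (borel_measurability measurable_kbranch).
- have ? : h = Delta_nonempty (mu s) by exact: Prop_irrelevance.
  by subst h.
- by move=> y /E; rewrite /preimage/= => ->.
Qed.

End strategy_belief.

(** * Best responses throughout the closure *)

Let sigma_belief i (t : Theta i) : Delta R (X (~~ i)) :=
  Delta_map (@sigma_continuous (~~ i)) (beta t).

Let approx i (t : Theta i) n (s' : X i) : R := \int[sigma_belief t]_y g n s' y.

Let approx_theta i (s : X i) (Ss : S i s) n s' :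
  approx (theta Ss) n s' = expected_approx s n s'.
Proof. by rewrite /approx /sigma_belief Delta_map_sigma_beta. Qed.

Let approxE i (t : Theta i) n s' : approx t n s' = \int[beta t]_v g n s' (sigma v).
Proof.
apply: (@Rintegral_map _ _ _ _ _ _ _ M) => [h|y]; last exact: g_bound.
by apply: continuous_borel; exact: g_continuous.
Qed.

Let approx_cvg i (t_ : nat -> Theta i) (t : Theta i) n (s_ : nat -> X i) s' :
  t_ @ \oo --> t -> s_ @ \oo --> s' ->
  approx (t_ m) n (s_ m) @[m --> \oo] --> approx t n s'.
Proof.
move=> tt ss; apply: (@eq_cvg_seq R (fun m => approx (t_ m) n (s_ m))
  (fun m => \int[beta (t_ m)]_v g n (s_ m) (sigma v)) _ _
  (fun m => approxE (t_ m) n (s_ m)) (approxE t n s')).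
have cg s : continuous (fun v : Theta (~~ i) => g n s (sigma v)).
  move=> v; exact: (cvg_comp _ _ (@sigma_continuous _ v) (@g_continuous i n s _)).
apply: (@beta_cvg_seq i t_ t (fun m v => g n (s_ m) (sigma v))
  (fun v => g n s' (sigma v)) M tt (fun m => cg (s_ m)) (cg s')).
- by move=> m v; exact: g_bound.
- by move=> v; exact: g_bound.
- move=> v_ v vv; apply: g_cvg_seq => //.
  exact: (cvg_comp _ _ vv (@sigma_continuous _ v)).
Qed.

Let sigma_cvg i (t_ : nat -> Theta i) (t : Theta i) :
  t_ @ \oo --> t -> sigma (t_ m) @[m --> \oo] --> sigma t.
Proof. by move=> tt; exact: (cvg_comp _ _ tt (@sigma_continuous _ t)). Qed.

Let theta_settled i (t : Theta i) k n n' :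
  (sval t (position (3, [::], k)) <= n)%N ->
  (sval t (position (3, [::], k)) <= n')%N ->
  approx t n (sigma t) - approx t n' (sigma t) <= eps k.
Proof.
have [s_ [Ss_ cv]] := theta_cvg t => tn tn'.
have c1 := cvgB (@approx_cvg _ _ _ n _ _ cv (sigma_cvg cv))
  (@approx_cvg _ _ _ n' _ _ cv (sigma_cvg cv)).
have c2 : cst (eps k) @ \oo --> eps k by exact: cvg_cst.
apply: (cvg_le_near (c1 _) c2).
apply: filterS (cvg_theta_nat (position (3, [::], k)) cv) => m mt.
rewrite /= in mt; rewrite -mt in tn tn'.
rewrite /= -[leLHS]/(approx _ _ _ - approx _ _ _) sigma_theta !approx_theta.
exact: le_trans (ler_norm _) (code_settled tn tn').
Qed.

(** If every rank from N to the recorded bound b failed, these finitely many strict inequalities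
    would pass to a strategy approximating t that records the same b and the same settled rank,
    contradicting [code_best_response]. *)
Let theta_best i (t : Theta i) k N s' : L N s' -> exists2 n, (N <= n)%N &
  approx t n s' <= approx t (sval t (position (3, [::], k))) (sigma t) + 2 * eps k.
Proof.
move=> Ls'; apply: contrapT => H.
pose b := sval t (position (4, [:: N], k)).
set m3 := sval t _ in H.
have lt n : (N <= n)%N -> 2 * eps k < approx t n s' - approx t m3 (sigma t).
  move=> Nn; rewrite ltNge; apply/negP => h; apply: H; exists n => //; lra.
have [s_ [Ss_ cv]] := theta_cvg t.
have c3 := cvg_theta_nat (position (3, [::], k)) cv.
have c4 := cvg_theta_nat (position (4, [:: N], k)) cv.
have cn : \forall m \near \oo, forall n : 'I_b.+1, (N <= n)%N ->
    2 * eps k < approx (theta (Ss_ m)) n s' -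
      approx (theta (Ss_ m)) m3 (sigma (theta (Ss_ m))).
  apply: (@filter_forall _ _ (fun (n : 'I_b.+1) m => (N <= n)%N ->
    2 * eps k < approx (theta (Ss_ m)) n s' -
      approx (theta (Ss_ m)) m3 (sigma (theta (Ss_ m))))) => n.
  have [Nn|nN] := leqP N n; last by apply: nearW.
  have c := cvgB (@approx_cvg _ _ _ n _ _ cv (cvg_cst s'))
    (@approx_cvg _ _ _ m3 _ _ cv (sigma_cvg cv)).
  by apply: filterS (cvgr_gt _ (c _ _) _ (lt n Nn)) => m h _; exact: h.
near \oo => m.
have e3 : sval (theta (Ss_ m)) (position (3, [::], k)) = m3 by near: m.
have e4 : sval (theta (Ss_ m)) (position (4, [:: N], k)) = b by near: m.
have := code_best_response k (Ss_ m) Ls'; rewrite /= in e3 e4.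
rewrite /settled e3 e4 => -[n [Nn nb]].
have : forall n : 'I_b.+1, (N <= n)%N ->
    2 * eps k < approx (theta (Ss_ m)) n s' -
      approx (theta (Ss_ m)) m3 (sigma (theta (Ss_ m))) by near: m.
move=> /(_ (Ordinal (nb : (n < b.+1)%N)) Nn) /=.
rewrite sigma_theta !approx_theta; lra.
Unshelve. all: end_near. Qed.

Lemma theta_best_response i (t : Theta i) :
  best_response pi (sigma t) (Delta_map (@sigma_continuous (~~ i)) (beta t)).
Proof.
move=> s'; rewrite -/(sigma_belief t).
have cJ : approx t n s' @[n --> \oo] --> expected_payoff pi s' (sigma_belief t).
  exact: expected_payoff_cvg.
have cV : approx t n (sigma t) @[n --> \oo] -->
    expected_payoff pi (sigma t) (sigma_belief t) by exact: expected_payoff_cvg.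
(* Of the four, two come from [theta_best], one from the settled rank, and one from replacing the
   competitor's payoff by its approximation at rank n. *)
apply: (@le_eps _ _ 4) => k; pose m3 := sval t (position (3, [::], k)).
have h1 : approx t m3 (sigma t) - eps k <=
    expected_payoff pi (sigma t) (sigma_belief t).
  have c1 : cst (approx t m3 (sigma t) - eps k) @ \oo -->
    (approx t m3 (sigma t) - eps k) by exact: cvg_cst.
  apply: (cvg_le_near c1 cV); near=> n.
  have := @theta_settled _ t k m3 n (leqnn _).
  have m3n : (m3 <= n)%N by near: n; exact: nbhs_infty_ge.
  by move=> /(_ m3n) /=; lra.
have /cvgrPdist_lt/(_ _ (eps_gt0 k))[n0 _ n0P] := cJ.
have [n1 _ n1P] := L_cover s'.
(* Beyond n1 the compact sets contain s', and beyond n0 its approximate payoffs are accurate; the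
   maximum ensures both. *)
have [n n01 nP] := theta_best t k (n1P (maxn n0 n1) (leq_maxr _ _)).
have := n0P n (leq_trans (leq_maxl _ _) n01); rewrite /= ltr_norml.
rewrite -/m3 in nP; lra.
Unshelve. all: end_near. Qed.

Lemma coding_RAT (pX : forall i, polish R (X i)) i s : S i s -> RAT pi i s.
Proof.
move=> Ss; rewrite -(sigma_theta Ss).
exact: (model_RAT pX beta_tight theta_best_response).
Qed.

Lemma coding_RCBR (pX : forall i, polish R (X i)) i s : S i s -> RCBR pi i s.
Proof.
move=> Ss; rewrite -(sigma_theta Ss).
exact: (model_RCBR pX beta_continuous beta_tight theta_best_response).
Qed.

End coding.

(** * Choice of the coding data and conclusion *)

Lemma outer_postfixed (R : realType) (X : bool -> topologicalType)
    (pX : forall i, polish R (X i))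
    (lX : forall i, locally_compact [set: X i])
    (pi : bool -> X false * X true -> R)
    (bpi : forall i, bounded_fun (pi i))
    (cpi : forall i, baire_class_one (pi i)) (S : forall i, set (X i)) :
  (forall i s, S i s -> exists mu : Delta R (X (~~ i)),
    outer_full mu (S (~~ i)) /\ best_response pi s mu) ->
  forall i s, S i s -> RAT pi i s /\ RCBR pi i s.
Proof.
move=> HS i0 s0 Ss0.
(* One strategy in S gives members for both players, since the empty set cannot have outer measure
   one. The metrics below are obtained only on nonempty spaces. *)
have S0 i : S i !=set0.
  have : S i0 !=set0 by exists s0.
  have opp j : S j !=set0 -> S (~~ j) !=set0.
    move=> [s /HS[mu [mu1 _]]]; apply/set0P/eqP => S0.
    have := mu1 set0 measurable0; rewrite S0 measure0 => /(_ (@subset_refl _ _)) /esym.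
    by move/eqP; rewrite onee_eq0.
  by case: i0 {s0 Ss0} => h; case: i => //; exact: (opp _ h).
have X0 i : [set: X i] !=set0 by have [s _] := S0 i; exists s.
have D0 i : exists mu : Delta R (X (~~ i)), True.
  by have [s /HS[mu _]] := S0 i; exists mu.
have dP i : polish_metric (sval (cid (polish_metricP (pX i) (X0 i))))
    (sval (cid (svalP (cid (polish_metricP (pX i) (X0 i)))))).
  exact: svalP (cid (svalP (cid (polish_metricP (pX i) (X0 i))))).
pose L i := sval (cid (compact_exhaustion (dP i) (lX i))).
have LP i : (forall n, compact (L i n)) /\ forall x, \forall n \near \oo, L i n x.
  exact: svalP (cid (compact_exhaustion (dP i) (lX i))).
pose g i := sval (cid (baire_payoff bpi cpi i)).
pose B i := sval (cid (svalP (cid (baire_payoff bpi cpi i)))).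
have gP i : [/\ forall n, continuous (fun p : X i * X (~~ i) => g i n p.1 p.2),
    forall n s y, `|g i n s y| <= B i
  & forall s y, g i n s y @[n --> \oo] --> payoff pi s y].
  exact: svalP (cid (svalP (cid (baire_payoff bpi cpi i)))).
have gB i n s y : `|g i n s y| <= Num.max (B false) (B true).
  have [_ + _] := gP i => /(_ n s y) h.
  by rewrite le_max; case: i s y h => s y ->; rewrite ?orbT.
(* The coding takes a belief for every strategy, so those outside S receive an arbitrary one. *)
have Hmu i (s : X i) : exists mu : Delta R (X (~~ i)),
    S i s -> outer_full mu (S (~~ i)) /\ best_response pi s mu.
  have [/HS[mu muP]|nS] := pselect (S i s); first by exists mu.
  by have [mu _] := D0 i; exists mu.
pose mu i s := sval (cid (Hmu i s)).
have muP i (s : X i) : S i s ->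
  outer_full (mu i s) (S (~~ i)) /\ best_response pi s (mu i s).
  exact: svalP (cid (Hmu i s)).
split.
  exact: (coding_RAT dP (fun i => (LP i).1) (fun i => (LP i).2)
    (fun i => let: And3 h _ _ := gP i in h) gB (fun i => let: And3 _ _ h := gP i in h)
    (fun i s Ss => (muP i s Ss).1) (fun i s Ss => (muP i s Ss).2) pX Ss0).
exact: (coding_RCBR dP (fun i => (LP i).1) (fun i => (LP i).2)
  (fun i => let: And3 h _ _ := gP i in h) gB (fun i => let: And3 _ _ h := gP i in h)
  (fun i s Ss => (muP i s Ss).1) (fun i s Ss => (muP i s Ss).2) pX Ss0).
Qed.

Theorem theorem1 (R : realType) (X : bool -> topologicalType)
    (X_polish : forall i, polish R (X i))
    (X_locally_compact : forall i, locally_compact [set: X i])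
    (pi : bool -> X false * X true -> R)
    (pi_bounded : forall i, bounded_fun (pi i))
    (pi_baire : forall i, baire_class_one (pi i)) :
  forall i, RAT pi i = RCBR pi i.
Proof.
have H := outer_postfixed X_polish X_locally_compact pi_bounded pi_baire.
move=> i; apply/seteqP; split=> s.
  move=> /RATP[S [SS Ss]]; apply: (proj2 (H S _ i s Ss)) => j t /SS[_ [mu muS br]].
  by exists mu; split=> //; exact: full_outer_full.
move=> rs; apply: (proj1 (H (fun j => RCBR pi j) _ i s rs)) => j t.
exact: RCBR_outer_full.
Qed.
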